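(* The function $\mathbf{N}(P,E)\mapsto\mathbf{M}_E(\mathbf{N})$ has the following properties. (1) If $\mathbf{N}_1(P_1,E_1)$ and $\mathbf{N}_2(P_2,E_2)$ are ported extensors with disjoint ground sets, $E=E_1\sqcup E_2$ and $P=P_1\sqcup P_2$, and $\mathbf{N}_1\mathbf{N}_2$ is regarded as the ported extensor with ports $P$ and non-port elements $E$, then \[\mathbf{M}_E(\mathbf{N}_1\mathbf{N}_2)=\epsilon(P_1P_2E)\,\epsilon(P_1E_1)\,\epsilon(P_2E_2)\;\mathbf{M}_{E_1}(\mathbf{N}_1)\,\mathbf{M}_{E_2}(\mathbf{N}_2).\] (2) If $e\in E$ and $E'=E\setminus e$ (the sequence $E$ with $e$ removed), then, regarding $\mathbf{N}/e$ and $\mathbf{N}\setminus e$ as ported extensors with ports $P$ and non-port elements $E'$, \[\mathbf{M}_E(\mathbf{N})=\epsilon(PE)\,\epsilon(PE')\big(g_e\mathbf{M}_{E'}(\mathbf{N}/e)+r_e\mathbf{M}_{E'}(\mathbf{N}\setminus e)\big).\] (3) If $E=\emptyset$, then for all sequences $I\subseteq P$ and $V\subseteq P$, with $\bar V=P\setminus V$, \[\mathbf{M}_\emptyset(\mathbf{N})[I_\iota V_\upsilon]=\epsilon(\bar V V)\,\mathbf{N}[I]\,\mathbf{N}[\bar V].\] (4) $\mathbf{M}_E(\mathbf{0})=\mathbf{0}$.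
   Context: $K$ is a field, extended if necessary by parameters $g_e,r_e$ ($e\in E$). For a finite set $S$, $\mathcal{E}(KS)$ is the exterior algebra over $KS$ with basis $S$; $\mathbf{s}$ is the image of $s$; for a sequence $A$ of distinct elements, $\mathbf{A}$ is the product of the $\mathbf{a}_i$ in order ($\mathbf{1}$ if empty). Set symbols denote sequences in an arbitrary order (results are stated only when independent of that choice up to the explicit sign factors, which refer to the chosen sequences); $AB$ is concatenation; $\bar X$ is the complement in the ground set in some order. An extensor with ground set $S$ is an element of $\mathcal{E}(KS)$ that is a scalar multiple of $\mathbf{1}$ or an exterior product of vectors; its Plücker coordinates are the alternating function $\mathbf{N}[A]$ with $\mathbf{N}=\sum_A\mathbf{N}[A]\mathbf{A}$. Deletion/contraction of $e$: $(\mathbf{N}\setminus e)[B]=\mathbf{N}[B]$, $(\mathbf{N}/e)[B]=\mathbf{N}[Be]$ (ground set $S\setminus e$); for a sequence $X=x_1\cdots x_k$, $\mathbf{N}/X=\mathbf{N}/x_k/\cdots/x_1$. A ground set orientation $\epsilon$ is an alternating function on finite sequences of ground set elements into $\{1,-1,0\}$, nonzero on sequences of distinct elements, $\epsilon(\emptyset)=1$; the canonical dual is $\mathbf{N}^\perp[X]=\mathbf{N}[\bar X]\epsilon(\bar X X)$. A ported extensor $\mathbf{N}(P,E)$ is an extensor with ground set $P\sqcup E$. Let $P_\iota=\{p_\iota\}$, $P_\upsilon=\{p_\upsilon\}$ be disjoint copies of $P$, disjoint from $E$; for a sequence $Q$ over $P$, $Q_\iota$ and $Q_\upsilon$ are the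 corresponding sequences. Let $\iota_g,\upsilon_r$ be the algebra homomorphisms $\mathcal{E}(K(P\sqcup E))\to\mathcal{E}(K(P_\iota\sqcup P_\upsilon\sqcup E))$ induced by $\mathbf{e}\mapsto g_e\mathbf{e},\ \mathbf{p}\mapsto\mathbf{p}_\iota$ and $\mathbf{e}\mapsto r_e\mathbf{e},\ \mathbf{p}\mapsto\mathbf{p}_\upsilon$. Define $\mathbf{M}(\mathbf{N})=\iota_g(\mathbf{N})\,\upsilon_r(\mathbf{N}^\perp)$ and, with $E$ a fixed sequence, $\mathbf{M}_E(\mathbf{N})=\mathbf{M}(\mathbf{N})/E$, an extensor with ground set $P_\iota\sqcup P_\upsilon$. *)

(* Defs.v *)
From HB Require Import structures.
From mathcomp Require Import all_boot all_order all_algebra.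

Set Implicit Arguments.
Unset Strict Implicit.
Unset Printing Implicit Defensive.

Import Order.TTheory GRing.Theory Num.Theory.
Local Open Scope ring_scope.

(* The exterior algebra over K T, for a finite set T taken as a basis.  An    *)
(* element is its family of coefficients on the monomials indexed by the      *)
(* subsets of T, where the monomial of a subset A is the product of its       *)
(* elements in the order of enum_rank.  For S : {set T}, the exterior algebra *)
(* over K S is identified with a subalgebra of ext K T.                       *)
Definition ext (K : fieldType) (T : finType) := {ffun {set T} -> K}.

HB.instance Definition _ (K : fieldType) (T : finType) :=
  GRing.Lmodule.copy (ext K T) {ffun {set T} -> K^o}.

Section ExtBasis.
Variables (K : fieldType) (T : finType).
Implicit Types (A B C : {set T}).

Definition ext_delta A : ext K T := [ffun C => (C == A)%:R].

(* The number of pairs to be exchanged in order to sort the product of the    *)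
(* monomial of A by that of B.                                                *)
Definition inversions A B : nat :=
  #|[set p : T * T | [&& p.1 \in A, p.2 \in B
                      & (enum_rank p.2 < enum_rank p.1)%N]]|.

Definition ext_delta_mul A B : ext K T :=
  if [disjoint A & B] then (-1) ^+ inversions A B *: ext_delta (A :|: B) else 0.

End ExtBasis.

HB.lock Definition ext_mul (K : fieldType) (T : finType) (x y : ext K T) :
    ext K T :=
  \sum_A \sum_B (x A * y B) *: ext_delta_mul K A B.

Section ExtAlgebra.
Variables (K : fieldType) (T : finType).
Implicit Types (A B C : {set T}) (x y z : ext K T).
Local Notation ext_delta := (@ext_delta K T).
Local Notation ext_delta_mul := (ext_delta_mul K).
Local Notation ext_mul := (@ext_mul K T).

Lemma ext_deltaE x : x = \sum_A x A *: ext_delta A.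
Proof.
apply/ffunP => C; rewrite sum_ffunE (bigD1 C) //= big1 => [|A neAC].
  by rewrite ffunE [ext_delta C C]ffunE eqxx addr0 [_ *: _]mulr1.
by rewrite ffunE [ext_delta A C]ffunE eq_sym (negPf neAC) [_ *: _]mulr0.
Qed.

Lemma ext_addE x y A : (x + y) A = x A + y A. Proof. by rewrite ffunE. Qed.

Lemma ext_scaleE (k : K) x A : (k *: x) A = k * x A.
Proof. by rewrite ffunE. Qed.

Lemma ext_mulDl : left_distributive ext_mul +%R.
Proof.
move=> x y z; rewrite !ext_mul.unlock -big_split /=; apply: eq_bigr => A _.
rewrite -big_split /=; apply: eq_bigr => B _.
by rewrite ext_addE mulrDl scalerDl.
Qed.

Lemma ext_mulDr : right_distributive ext_mul +%R.
Proof.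
move=> x y z; rewrite !ext_mul.unlock -big_split /=; apply: eq_bigr => A _.
rewrite -big_split /=; apply: eq_bigr => B _.
by rewrite ext_addE mulrDr scalerDl.
Qed.

Lemma ext_mulZl k x y : ext_mul (k *: x) y = k *: ext_mul x y.
Proof.
rewrite !ext_mul.unlock scaler_sumr; apply: eq_bigr => A _.
rewrite scaler_sumr; apply: eq_bigr => B _.
by rewrite ext_scaleE scalerA mulrA.
Qed.

Lemma ext_mulZr k x y : ext_mul x (k *: y) = k *: ext_mul x y.
Proof.
rewrite !ext_mul.unlock scaler_sumr; apply: eq_bigr => A _.
rewrite scaler_sumr; apply: eq_bigr => B _.
by rewrite ext_scaleE scalerA mulrCA.
Qed.

Lemma ext_mul0l y : ext_mul 0 y = 0.
Proof. by rewrite -[X in ext_mul X _](scale0r (0 : ext K T)) ext_mulZl scale0r. Qed.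

Lemma ext_mul0r y : ext_mul y 0 = 0.
Proof. by rewrite -[X in ext_mul _ X](scale0r (0 : ext K T)) ext_mulZr scale0r. Qed.

Lemma ext_mul_suml I (s : seq I) (P : pred I) F y :
  ext_mul (\sum_(i <- s | P i) F i) y = \sum_(i <- s | P i) ext_mul (F i) y.
Proof.
by apply: (big_morph (ext_mul^~ y)) => [u v|]; rewrite ?ext_mulDl ?ext_mul0l.
Qed.

Lemma ext_mul_sumr I (s : seq I) (P : pred I) F y :
  ext_mul y (\sum_(i <- s | P i) F i) = \sum_(i <- s | P i) ext_mul y (F i).
Proof.
by apply: (big_morph (ext_mul y)) => [u v|]; rewrite ?ext_mulDr ?ext_mul0r.
Qed.

Lemma ext_mul_delta A B : ext_mul (ext_delta A) (ext_delta B) = ext_delta_mul A B.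
Proof.
rewrite ext_mul.unlock (bigD1 A) //= [X in _ + X]big1 ?addr0 => [|C neCA].
  rewrite (bigD1 B) //= big1 ?addr0 => [|C neCB].
    by rewrite !ffunE !eqxx mulr1 scale1r.
  by rewrite !ffunE (negPf neCB) mulr0 scale0r.
by rewrite big1 // => B' _; rewrite !ffunE (negPf neCA) mul0r scale0r.
Qed.

Lemma inversionsUl A B C :
  [disjoint A & B] -> inversions (A :|: B) C = (inversions A C + inversions B C)%N.
Proof.
move=> dAB; rewrite /inversions -cardsUI -[LHS]addn0; congr (_ + _)%N.
  by congr #|pred_of_set _|; apply/setP=> p; rewrite !inE /= andb_orl.
apply/esym/eqP; rewrite cards_eq0; apply/eqP/setP=> p; rewrite !inE.
by case: (boolP (p.1 \in A)) => //= /(disjointFr dAB) ->; rewrite andbF.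
Qed.

Lemma inversionsUr A B C :
  [disjoint B & C] -> inversions A (B :|: C) = (inversions A B + inversions A C)%N.
Proof.
move=> dBC; rewrite /inversions -cardsUI -[LHS]addn0; congr (_ + _)%N.
  congr #|pred_of_set _|; apply/setP=> p; rewrite !inE /=.
  by rewrite andb_orl andb_orr.
apply/esym/eqP; rewrite cards_eq0; apply/eqP/setP=> p; rewrite !inE.
case: (boolP (p.2 \in B)) => [/(disjointFr dBC) ->|_]; last by rewrite andbF.
by rewrite !andbF.
Qed.

Lemma ext_mul_deltaA A B C :
  ext_mul (ext_delta A) (ext_mul (ext_delta B) (ext_delta C))
  = ext_mul (ext_mul (ext_delta A) (ext_delta B)) (ext_delta C).
Proof.
have dU (X Y Z : {set T}) :
    [disjoint X :|: Y & Z] = [disjoint X & Z] && [disjoint Y & Z].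
  by rewrite -!setI_eq0 setIUl setU_eq0.
rewrite !ext_mul_delta /ext_delta_mul.
case: (boolP [disjoint B & C]) => dBC; case: (boolP [disjoint A & B]) => dAB;
  rewrite ?ext_mulZl ?ext_mulZr ?ext_mul0l ?ext_mul0r ?ext_mul_delta
    /ext_delta_mul //.
- rewrite dU dBC andbT disjoint_sym dU !(disjoint_sym _ A) dAB /=.
  case: ifP => _; last by rewrite !scaler0.
  rewrite !scalerA -!exprD inversionsUl // inversionsUr // setUA.
  by rewrite addnC addnA.
- by rewrite disjoint_sym dU [X in X && _]disjoint_sym (negPf dAB) scaler0.
- by rewrite dU (negPf dBC) andbF scaler0.
Qed.

Lemma ext_mulA : associative ext_mul.
Proof.
move=> x y z; rewrite [x]ext_deltaE !ext_mul_suml; apply: eq_bigr => A _.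
rewrite !ext_mulZl; congr (_ *: _).
rewrite [y]ext_deltaE ext_mul_suml !ext_mul_sumr ext_mul_suml.
apply: eq_bigr => B _; rewrite !(ext_mulZl, ext_mulZr); congr (_ *: _).
rewrite [z]ext_deltaE !ext_mul_sumr; apply: eq_bigr => C _.
by rewrite !ext_mulZr ext_mul_deltaA.
Qed.

Lemma ext_mul1l : left_id (ext_delta set0) ext_mul.
Proof.
move=> x; rewrite [x]ext_deltaE ext_mul_sumr; apply: eq_bigr => A _.
rewrite ext_mulZr ext_mul_delta /ext_delta_mul disjoints_subset sub0set set0U.
rewrite /inversions (_ : [set _ | _] = set0) ?cards0 ?expr0 ?scale1r //.
by apply/setP=> p; rewrite !inE.
Qed.

Lemma ext_mul1r : right_id (ext_delta set0) ext_mul.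
Proof.
move=> x; rewrite [x]ext_deltaE ext_mul_suml; apply: eq_bigr => A _.
rewrite ext_mulZl ext_mul_delta /ext_delta_mul disjoint_sym disjoints_subset.
rewrite sub0set setU0.
rewrite /inversions (_ : [set _ | _] = set0) ?cards0 ?expr0 ?scale1r //.
by apply/setP=> p; rewrite !inE andbF.
Qed.

Lemma ext_delta0_neq0 : ext_delta set0 != 0.
Proof.
by apply/eqP=> /ffunP/(_ set0); rewrite !ffunE eqxx => /eqP; rewrite oner_eq0.
Qed.

End ExtAlgebra.

HB.instance Definition _ (K : fieldType) (T : finType) :=
  GRing.Zmodule_isNzRing.Build (ext K T) (@ext_mulA K T) (@ext_mul1l K T)
    (@ext_mul1r K T) (@ext_mulDl K T) (@ext_mulDr K T) (@ext_delta0_neq0 K T).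

HB.instance Definition _ (K : fieldType) (T : finType) :=
  GRing.Lmodule_isLalgebra.Build K (ext K T)
    (fun k x y => esym (ext_mulZl k x y)).

HB.instance Definition _ (K : fieldType) (T : finType) :=
  GRing.Lalgebra_isAlgebra.Build K (ext K T)
    (fun k x y => esym (ext_mulZr k x y)).

Definition alternating (T : eqType) (V : zmodType) (f : seq T -> V) :=
  (forall s, ~~ uniq s -> f s = 0) /\
  (forall s1 a s2 b s3,
     f (s1 ++ a :: s2 ++ b :: s3) = - f (s1 ++ b :: s2 ++ a :: s3)).

Definition orientation (T : eqType) (eps : seq T -> int) :=
  [/\ alternating eps,
      forall s, eps s \in [:: 1; -1; 0],
      forall s, uniq s -> eps s != 0
    & eps [::] = 1].

Section Extensors.
Variables (K : fieldType) (T : finType).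
Implicit Types (S : {set T}) (N : ext K T) (A B : seq T).

Definition ext_gen (a : T) : ext K T := ext_delta K [set a].

Definition ext_mon A : ext K T := \prod_(a <- A) ext_gen a.

Definition is_vector S N := exists c : T -> K, N = \sum_(a in S) c a *: ext_gen a.

Definition extensor S N :=
  (exists c : K, N = c *: 1) \/
  (exists2 vs : seq (ext K T),
     {in vs, forall v, is_vector S v} & N = \prod_(v <- vs) v).

(* The Pluecker coordinate N[A]: when A has distinct elements, ext_mon A is   *)
(* the basis monomial of [set:: A] up to a sign, which is the first factor;   *)
(* otherwise that factor is 0.                                                *)
Definition plucker N A : K := ext_mon A [set:: A] * N [set:: A].

(* The element of the exterior algebra over K S whose Pluecker coordinates on *)
(* sequences over S are given by the alternating function f; by               *)
(* pluckerK below, the ordering of the sets X used here is immaterial.        *)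
Definition ext_of S (f : seq T -> K) : ext K T :=
  \sum_(X : {set T} | X \subset S) f (enum X) *: ext_mon (enum X).

(* For N with ground set S containing e, N \ e and N / e have ground set      *)
(* S :\ e.  There is no need to mention S: Pluecker coordinates on sequences  *)
(* that leave the ground set are zero.                                        *)
Definition deletion N (e : T) := ext_of [set~ e] (plucker N).

Definition contraction N (e : T) :=
  ext_of [set~ e] (fun B => plucker N (rcons B e)).

(* N / x_1...x_k = N / x_k / ... / x_1 *)
Definition contraction_seq N A := foldr (fun x N' => contraction N' x) N A.

Definition dual (eps : seq T -> int) S N : ext K T :=
  ext_of S (fun X => let Xbar := enum (S :\: [set:: X]) in
                     plucker N Xbar * (eps (Xbar ++ X))%:~R).

End Extensors.

(* When all f a are vectors, this is the algebra homomorphism induced by f:   *)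
(* see ext_lift_linear, ext_lift_monoid_morphism and ext_lift_gen.            *)
Definition ext_lift (K : fieldType) (T T' : finType) (f : T -> ext K T')
    (N : ext K T) : ext K T' :=
  \sum_(A : {set T}) plucker N (enum A) *: \prod_(a <- enum A) f a.


Section AlternatingTheory.
Variables (T : eqType).
Implicit Types (s t : seq T).

Lemma perm_eq_adj (X : Type) (F : seq T -> X) s t :
  (forall s1 a b s2, F (s1 ++ a :: b :: s2) = F (s1 ++ b :: a :: s2)) ->
  perm_eq s t -> F s = F t.
Proof.
elim: s F t => [|a s IHs] F t swapF.
  by rewrite perm_sym => /perm_nilP ->.
move=> eq_st; have at_: a \in t by rewrite -(perm_mem eq_st) mem_head.
case/splitPr: at_ eq_st => t1 t2 eq_st.
have -> : F (t1 ++ a :: t2) = F (a :: t1 ++ t2).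
  elim/last_ind: t1 t2 {eq_st} => [|t1 b IHt] t2 //.
  by rewrite !cat_rcons swapF IHt.
apply: (IHs (fun s' => F (a :: s'))) => [s1 b c s2|].
  exact: (swapF (a :: s1)).
move: eq_st; rewrite [in X in X -> _]perm_sym => eq_st.
by rewrite -(perm_cons a) perm_sym (perm_trans _ eq_st) // -cat1s perm_catCA.
Qed.

Lemma alternating_scale (K : fieldType) (V : lmodType K) (f : seq T -> K)
    (h : seq T -> V) s t :
  alternating f -> alternating h -> perm_eq s t -> f s *: h s = f t *: h t.
Proof.
move=> [_ fN] [_ hN]; apply: (perm_eq_adj (F := fun s => f s *: h s)).
move=> s1 a b s2.
by rewrite (fN s1 a [::] b s2) (hN s1 a [::] b s2) scaleNr scalerN opprK.
Qed.

Lemma not_uniq_split s :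
  ~~ uniq s -> exists s1 a s2 s3, s = s1 ++ a :: s2 ++ a :: s3.
Proof.
elim: s => //= a s IHs; rewrite negb_and negbK => /orP[].
  by case/splitPr => s2 s3; exists [::], a, s2, s3.
by case/IHs=> [s1 [b [s2 [s3 ->]]]]; exists (a :: s1), b, s2, s3.
Qed.

Lemma alternating_prod (R : nzRingType) (f : T -> R) :
    (forall a, f a * f a = 0) -> (forall a b, f a * f b = - (f b * f a)) ->
  alternating (fun s => \prod_(a <- s) f a).
Proof.
move=> f0 fN; have fC a s : f a * \prod_(b <- s) f b
    = (-1) ^+ size s * (\prod_(b <- s) f b * f a).
  elim: s => [|b s IHs]; first by rewrite big_nil mulr1 !mul1r.
  rewrite !big_cons /= [LHS]mulrA fN mulNr -[X in - X]mulrA IHs.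
  rewrite exprS mulN1r mulNr; congr (- _).
  by rewrite [LHS]mulrA [in LHS](commr_sign (f b)) -!mulrA.
have cat3 s1 a s2 b s3 : \prod_(c <- s1 ++ a :: s2 ++ b :: s3) f c
    = (-1) ^+ size s2 * (\prod_(c <- s1) f c * (\prod_(c <- s2) f c
        * (f a * f b)) * \prod_(c <- s3) f c).
  rewrite !(big_cat, big_cons) /=.
  rewrite [f a * _]mulrA fC -!mulrA [LHS]mulrA [X in X * _ = _]commr_sign.
  by rewrite -!mulrA.
split=> [s /not_uniq_split[s1 [a [s2 [s3 ->]]]]|s1 a s2 b s3].
  by rewrite cat3 f0 !(mulr0, mul0r).
by rewrite !cat3 fN !(mulrN, mulNr).
Qed.

End AlternatingTheory.

Section ExtTheory.
Variables (K : fieldType) (T : finType).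
Implicit Types (S : {set T}) (N : ext K T) (s t A B : seq T).
Local Notation gen := (@ext_gen K T).

Lemma ext_mul_mulE N1 N2 : ext_mul N1 N2 = N1 * N2. Proof. by []. Qed.

Lemma ext_gen_sq a : gen a * gen a = 0.
Proof.
rewrite -ext_mul_mulE ext_mul_delta /ext_delta_mul disjoints1 inE eqxx //.
Qed.

Lemma inversions1 (a b : T) :
  inversions [set a] [set b] = (enum_rank b < enum_rank a)%N.
Proof.
set c := (X in nat_of_bool X); have -> : nat_of_bool c = #|[set p in [set (a, b)] | c]|.
  by rewrite setIdE; case: c; rewrite (setIT, setI0) (cards1, cards0).
congr #|pred_of_set _|; apply/setP=> -[x y]; rewrite !inE xpair_eqE /= {}/c.
by case: eqP => //= ->; case: eqP => //= ->.
Qed.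

Lemma ext_gen_anti a b : gen a * gen b = - (gen b * gen a).
Proof.
have [->|neab] := eqVneq a b; first by rewrite ext_gen_sq oppr0.
rewrite -!ext_mul_mulE !ext_mul_delta /ext_delta_mul !disjoints1 !inE.
rewrite (eq_sym b) neab setUC -scaleNr; congr (_ *: _).
rewrite !inversions1; case: ltngtP => [_|_|/val_inj/enum_rank_inj eqab].
- by rewrite expr0 expr1 ?opprK.
- by rewrite expr0 expr1 ?opprK.
- by rewrite eqab eqxx in neab.
Qed.

Lemma ext_monM s t : ext_mon K (s ++ t) = ext_mon K s * ext_mon K t.
Proof. by rewrite /ext_mon big_cat. Qed.

Lemma alternating_mon : alternating (@ext_mon K T).
Proof. exact: alternating_prod ext_gen_sq ext_gen_anti. Qed.

Lemma ext_mon_delta s : uniq s ->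
  ext_mon K s = ext_mon K s [set:: s] *: ext_delta K [set:: s]
  /\ ext_mon K s [set:: s] ^+ 2 = 1.
Proof.
elim: s => [_|a s IHs /= /andP[as_ /IHs[{}IHs IH2]]].
  rewrite /ext_mon big_nil; have -> : [set:: [::]] = set0 :> {set T}.
    by apply/setP=> x; rewrite !inE.
  by rewrite !ffunE eqxx scale1r expr1n.
have E : ext_mon K (a :: s) = (-1) ^+ inversions [set a] [set:: s]
    * ext_mon K s [set:: s] *: ext_delta K [set:: a :: s].
  rewrite {1}/ext_mon big_cons -/(ext_mon K s) {1}IHs -ext_mul_mulE.
  rewrite ext_mulZr ext_mul_delta /ext_delta_mul disjoints1 inE as_ scalerA.
  rewrite mulrC; congr (_ *: ext_delta K _).
  by apply/setP=> x; rewrite !inE.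
rewrite E !ext_scaleE [ext_delta K _ _]ffunE eqxx mulr1; split=> //.
by rewrite exprMn IH2 mulr1 sqrr_sign.
Qed.

Lemma eq_set_perm s t : uniq s -> uniq t -> ([set:: s] == [set:: t]) = perm_eq s t.
Proof.
move=> us ut; apply/eqP/idP => [/setP eq_st|/perm_mem eq_st].
  by apply: uniq_perm => // x; have := eq_st x; rewrite !inE.
by apply/setP=> x; rewrite !inE eq_st.
Qed.

Lemma plucker_alternating N : alternating (plucker N).
Proof.
have [m0 mN] := alternating_mon; split=> [s us|s1 a s2 b s3].
  by rewrite /plucker m0 // ffunE mul0r.
rewrite /plucker mN ffunE mulNr.
suff -> : [set:: s1 ++ a :: s2 ++ b :: s3] = [set:: s1 ++ b :: s2 ++ a :: s3].
  by [].
by apply/setP=> x; rewrite !(inE, mem_cat); do !bool_congr.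
Qed.

Lemma plucker_mon_neq s t :
  uniq s -> uniq t -> ~~ perm_eq s t -> plucker (ext_mon K s) t = 0.
Proof.
move=> us ut; rewrite -eq_set_perm // eq_sym => neq_st.
have [-> _] := ext_mon_delta us.
by rewrite /plucker ext_scaleE [ext_delta K _ _]ffunE (negPf neq_st) !mulr0.
Qed.

Lemma plucker_mon_id s : uniq s -> plucker (ext_mon K s) s = 1.
Proof. by move=> /ext_mon_delta[_ <-]; rewrite /plucker expr2. Qed.

Lemma plucker_mon_perm (V : lmodType K) (h : seq T -> V) s t :
  alternating h -> uniq s -> perm_eq s t -> plucker (ext_mon K s) t *: h t = h s.
Proof.
move=> h_alt us eq_st.
rewrite -(alternating_scale (plucker_alternating _) h_alt eq_st).
by rewrite plucker_mon_id // scale1r.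
Qed.

Lemma plucker_sum I (r : seq I) (P : pred I) (F : I -> ext K T) A :
  plucker (\sum_(i <- r | P i) F i) A = \sum_(i <- r | P i) plucker (F i) A.
Proof.
apply: (big_morph (fun N => plucker N A)) => [N1 N2|].
  by rewrite /plucker ffunE mulrDr.
by rewrite /plucker ffunE mulr0.
Qed.

Lemma pluckerZ (c : K) N A : plucker (c *: N) A = c * plucker N A.
Proof. by rewrite /plucker ext_scaleE mulrCA. Qed.

Lemma ext_pluckerE (o : {set T} -> seq T) N :
    (forall A : {set T}, uniq (o A) /\ o A =i A) ->
  N = \sum_(A : {set T}) plucker N (o A) *: ext_mon K (o A).
Proof.
move=> oP; rewrite [LHS]ext_deltaE; apply: eq_bigr => A _.
have [uA oA] := oP A; have [E1 E2] := ext_mon_delta uA.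
have sA : [set:: o A] = A by apply/setP=> x; rewrite !inE oA.
rewrite [in RHS]E1 scalerA /plucker mulrAC -expr2 sA.
by move: E2; rewrite sA => ->; rewrite mul1r.
Qed.

Lemma pluckerK S (f : seq T -> K) B : alternating f -> {subset B <= S} ->
  plucker (ext_of S f) B = f B.
Proof.
move=> f_alt sBS; have [uB|nuB] := boolP (uniq B); last first.
  by rewrite (plucker_alternating _).1 // f_alt.1.
have sB : [set:: B] \subset S by apply/subsetP=> x; rewrite inE => /sBS.
have perm_B : perm_eq (enum [set:: B]) B.
  by apply: uniq_perm; rewrite ?enum_uniq // => x; rewrite mem_enum inE.
rewrite plucker_sum (bigD1 [set:: B]) //= [X in _ + X]big1 => [|A /andP[_ neAB]].
  rewrite addr0 (alternating_scale f_alt alternating_mon perm_B).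
  by rewrite pluckerZ plucker_mon_id // mulr1.
rewrite pluckerZ plucker_mon_neq ?mulr0 ?enum_uniq //.
rewrite -eq_set_perm ?enum_uniq //; apply: contraNneq neAB => <-.
by apply/eqP/setP=> x; rewrite inE mem_enum.
Qed.

Lemma pluckerK_out S (f : seq T -> K) B :
  ~~ ([set:: B] \subset S) -> plucker (ext_of S f) B = 0.
Proof.
have [uB|nuB _] := boolP (uniq B); last by rewrite (plucker_alternating _).1.
move=> nsB; rewrite plucker_sum big1 // => A sAS; rewrite pluckerZ.
rewrite plucker_mon_neq ?mulr0 ?enum_uniq // -eq_set_perm ?enum_uniq //.
apply: contraNneq nsB => <-; apply: subset_trans sAS.
by apply/subsetP=> x; rewrite inE mem_enum.
Qed.

Lemma plucker_deletion N (e : T) B :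
  e \notin B -> plucker (deletion N e) B = plucker N B.
Proof.
move=> eB; apply: pluckerK (plucker_alternating N) _ => x xB.
by rewrite !inE; apply: contraNneq eB => <-.
Qed.

Lemma plucker_contraction N (e : T) B :
  e \notin B -> plucker (contraction N e) B = plucker N (rcons B e).
Proof.
have [N0 NN] := plucker_alternating N.
move=> eB; apply: pluckerK (_ : alternating (fun B => _)) _ => [|x xB].
  split=> [s us|s1 a s2 b s3]; first by rewrite N0 // rcons_uniq negb_and us orbT.
  by rewrite !(rcons_cat, rcons_cons) NN.
by rewrite !inE; apply: contraNneq eB => <-.
Qed.

Lemma plucker_dual (eps : seq T -> int) S N X Xbar :
    orientation eps -> {subset X <= S} ->
    uniq Xbar -> Xbar =i [predD S & X] ->
  plucker (dual eps S N) X = plucker N Xbar * (eps (Xbar ++ X))%:~R.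
Proof.
move=> [[e0 eN] _ _ _] sXS uXbar XbarE.
rewrite /dual pluckerK //; last first.
  split=> [s us|s1 a s2 b s3] /=.
    by rewrite e0 ?mulr0 // cat_uniq (negPf us) !andbF.
  have <- : [set:: s1 ++ a :: s2 ++ b :: s3] = [set:: s1 ++ b :: s2 ++ a :: s3].
    by apply/setP=> x; rewrite !(inE, mem_cat); do !bool_congr.
  by rewrite !catA eN mulrNz mulrN -!catA.
have perm_Xbar : perm_eq (enum (S :\: [set:: X])) Xbar.
  apply: uniq_perm; rewrite ?enum_uniq // => x.
  by rewrite mem_enum XbarE !inE.
rewrite ![_ * _%:~R](mulrC _ (_%:~R)).
apply: (alternating_scale (V := K^o) (f := fun Y => (eps (Y ++ X))%:~R) _
  (plucker_alternating N) perm_Xbar).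
split=> [s us|s1 a s2 b s3]; first by rewrite e0 // cat_uniq (negPf us).
by rewrite -!(catA, cat_cons) eN mulrNz.
Qed.

Lemma is_vectorZ S (k : K) N : is_vector S N -> is_vector S (k *: N).
Proof.
move=> [c ->]; exists (fun a => k * c a); rewrite scaler_sumr.
by apply: eq_bigr => a _; rewrite scalerA.
Qed.

Lemma is_vector_gen (a : T) : is_vector [set: T] (gen a).
Proof.
exists (fun b => (b == a)%:R); rewrite (bigD1 a) ?inE //= eqxx scale1r.
by rewrite big1 ?addr0 // => b /andP[_ /negPf->]; rewrite scale0r.
Qed.

End ExtTheory.

Section LiftTheory.
Variables (K : fieldType) (T T' : finType) (f : T -> ext K T').
Hypothesis f_vect : forall a, is_vector [set: T'] (f a).

Lemma is_vector_anti (v w : ext K T') :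
  is_vector [set: T'] v -> is_vector [set: T'] w -> v * w = - (w * v).
Proof.
move=> [c ->] [d ->]; rewrite mulr_suml mulr_sumr -sumrN.
apply: eq_bigr => a _; rewrite mulr_sumr mulr_suml -sumrN.
apply: eq_bigr => b _; rewrite -!(scalerAl, scalerAr) ext_gen_anti !scalerN.
by rewrite !scalerA mulrC.
Qed.

Lemma is_vector_sq (v : ext K T') : is_vector [set: T'] v -> v * v = 0.
Proof.
move=> [c ->]; elim: (index_enum T') => [|a s IHs]; first by rewrite big_nil mul0r.
rewrite big_cons inE mulrDl !mulrDr IHs addr0 -scalerAl -scalerAr ext_gen_sq.
rewrite !scaler0 add0r addrC; apply/eqP; rewrite addr_eq0; apply/eqP.
rewrite mulr_suml mulr_sumr -sumrN; apply: eq_bigr => b _.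
by rewrite -!(scalerAl, scalerAr) ext_gen_anti !scalerN !scalerA mulrC.
Qed.

Lemma ext_lift_linear : linear (ext_lift f).
Proof.
move=> c N1 N2; rewrite /ext_lift scaler_sumr -big_split /=.
apply: eq_bigr => A _; rewrite scalerA -scalerDl; congr (_ *: _).
by rewrite /plucker !ffunE mulrDr mulrCA.
Qed.

HB.instance Definition _ :=
  GRing.isLinear.Build K (ext K T) (ext K T') _ (ext_lift f) ext_lift_linear.

Lemma ext_lift_mon s : ext_lift f (ext_mon K s) = \prod_(a <- s) f a.
Proof.
have F_alt : alternating (fun s => \prod_(a <- s) f a).
  by apply: alternating_prod => *; [apply: is_vector_sq|apply: is_vector_anti].
have [us|nus] := boolP (uniq s); last first.
  by rewrite (alternating_mon _ _).1 // raddf0 F_alt.1.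
have perm_s : perm_eq s (enum [set:: s]).
  by apply: uniq_perm; rewrite ?enum_uniq // => x; rewrite mem_enum inE.
rewrite /ext_lift (bigD1 [set:: s]) //= [X in _ + X]big1 => [|A neAs].
  by rewrite addr0 (plucker_mon_perm F_alt).
rewrite plucker_mon_neq ?scale0r ?enum_uniq // -eq_set_perm ?enum_uniq //.
apply: contraNneq neAs => ->; apply/eqP/setP=> x; rewrite inE mem_enum //.
Qed.

Lemma ext_lift_gen a : ext_lift f (ext_gen K a) = f a.
Proof. by have := ext_lift_mon [:: a]; rewrite /ext_mon !big_seq1. Qed.

Lemma ext_lift_monoid_morphism : monoid_morphism (ext_lift f).
Proof.
split=> [|N1 N2]; first by have := ext_lift_mon [::]; rewrite /ext_mon !big_nil.
have enumP (A : {set T}) : uniq (enum A) /\ enum A =i A.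
  by split; [apply: enum_uniq|apply: mem_enum].
rewrite [N1](ext_pluckerE _ enumP) [N2](ext_pluckerE _ enumP).
rewrite mulr_suml !linear_sum mulr_suml; apply: eq_bigr => A _.
rewrite mulr_sumr !linear_sum mulr_sumr; apply: eq_bigr => B _.
rewrite -scalerAl -scalerAr !linearZ -scalerAl -scalerAr; do 2!congr (_ *: _).
by rewrite -ext_monM /= !ext_lift_mon big_cat.
Qed.

End LiftTheory.

(* The ground set P_iota + P_upsilon + E of M(N) lies in U + U + U. *)
Section Ported.
Variables (K : fieldType) (U : finType).

Definition port_iota (p : U) : U + U + U := inl (inl p).
Definition port_upsilon (p : U) : U + U + U := inl (inr p).
Definition nonport (e : U) : U + U + U := inr e.

(* A ground set is given by the sequences P of its ports and E of its other   *)
(* elements; only the order of E affects ext_ME.                              *)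
Definition ported (P E : seq U) (N : ext K U) :=
  uniq (P ++ E) /\ extensor [set:: P ++ E] N.

Definition iota_gen (g : U -> K) (P : seq U) (u : U) : ext K (U + U + U)%type :=
  if u \in P then ext_gen K (port_iota u) else g u *: ext_gen K (nonport u).

Definition upsilon_gen (r : U -> K) (P : seq U) (u : U) : ext K (U + U + U)%type :=
  if u \in P then ext_gen K (port_upsilon u) else r u *: ext_gen K (nonport u).

Definition iota_g g P := ext_lift (iota_gen g P).

Definition upsilon_r r P := ext_lift (upsilon_gen r P).

Lemma iota_gen_vector g P u : is_vector [set: U + U + U] (iota_gen g P u).
Proof. by rewrite /iota_gen; case: ifP => _; auto using is_vector_gen, is_vectorZ. Qed.

Lemma upsilon_gen_vector r P u : is_vector [set: U + U + U] (upsilon_gen r P u).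
Proof. by rewrite /upsilon_gen; case: ifP => _; auto using is_vector_gen, is_vectorZ. Qed.

HB.instance Definition _ g P := GRing.isLinear.Build K (ext K U) (ext K (U + U + U)%type)
  _ (iota_g g P) (ext_lift_linear (iota_gen g P)).
HB.instance Definition _ g P := GRing.isMonoidMorphism.Build (ext K U)
  (ext K (U + U + U)%type) (iota_g g P)
  (ext_lift_monoid_morphism (iota_gen_vector g P)).

HB.instance Definition _ r P := GRing.isLinear.Build K (ext K U) (ext K (U + U + U)%type)
  _ (upsilon_r r P) (ext_lift_linear (upsilon_gen r P)).
HB.instance Definition _ r P := GRing.isMonoidMorphism.Build (ext K U)
  (ext K (U + U + U)%type) (upsilon_r r P)
  (ext_lift_monoid_morphism (upsilon_gen_vector r P)).

Definition ext_M eps (g r : U -> K) (P E : seq U) (N : ext K U) :=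
  iota_g g P N * upsilon_r r P (dual eps [set:: P ++ E] N).

Definition ext_ME eps (g r : U -> K) (P E : seq U) (N : ext K U) :=
  contraction_seq (ext_M eps g r P E N) (map nonport E).

End Ported.

(* Main.v *)
(* The identities only involve degrees modulo 2, so each is checked on monomials  *)
(* and extended by (bi)linearity to homogeneous elements.  On a monomial A with    *)
(* complement X the dual is eps(A X) X; hence, writing S1 and S2 for the ground    *)
(* sets, the dual of N1 N2 is eps(S1 S2) eps(S1) eps(S2) times the product of the  *)
(* duals, up to a sign that cancels when iota(N2) is moved past upsilon(N1^dual).  *)
(* Part (2) comes from N = (N \ e) + (N / e) e and from e e = 0: in the product    *)
(* M(N) the terms ending in e are g_e M(N / e) e and r_e M(N \ e) e, up to the     *)
(* common sign eps(P E) eps(P E').                                                 *)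

Require Import Defs.
From mathcomp Require Import all_boot all_order all_algebra.
From mathcomp Require Import ring.

Set Implicit Arguments.
Unset Strict Implicit.
Unset Printing Implicit Defensive.

Import Order.TTheory GRing.Theory Num.Theory.
Local Open Scope ring_scope.

(** An extensor is homogeneous, and on homogeneous elements every operation used here is determined
    by its effect on monomials. The dual sends a monomial A to eps(A X) X, where X is the complement
    of A; contraction by e strips a final e and kills monomials without e. Signs are therefore
    parities of block exchanges ([alternating_catCA]), and choices of order cancel because reordered
    sequences occur in pairs of alternating factors.

    Product: by [dual_mul], dualizing N1 N2 costs eps(S1 S2) eps(S1) eps(S2) and the sign of
    exchanging N2 with the dual of N1. Commuting iota(N2) with upsilon(N1^dual) undoes the latter
    ([ext_M_mul]). Contracting by E1 after E2 passes a factor of parity |P2|, and this sign turns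
    eps(P1 E1 P2 E2) into eps(P1 P2 E1 E2) ([ext_ME_mul]).

    Recursion on e: write N = x + y e with x = N \ e and y = N / e. With the common sign c = eps(P
    E' e) eps(P E'), the dual of x gains a final e and the dual of y e loses e ([dual_extend],
    [dual_extend_mul_gen]). In M(N), the term from y e and the dual of x contains e e = 0, the term
    from x and the dual of y e has no e and dies under contraction, and the other two give r_e M(N \
    e) and g_e M(N / e) ([ext_M_contraction]).

    If E is empty, iota and upsilon map to disjoint sets of generators, so Pluecker coordinates
    multiply ([plucker_ports]). The value at 0 follows by linearity. *)

Section Signs.

(** * Signs of block exchanges and of ground set orientations *)

Variables (T : eqType) (K : fieldType).
Implicit Types s t : seq T.

Lemma alternating_cons_cat (V : lmodType K) (f : seq T -> V) s1 a s2 s3 :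
  alternating f ->
  f (s1 ++ a :: s2 ++ s3) = (-1) ^+ odd (size s2) *: f (s1 ++ s2 ++ a :: s3).
Proof.
move=> [_ fN]; elim: s2 s1 => [|b s2 IHs] s1; first by rewrite scale1r.
by rewrite (fN s1 a [::] b) -cat_rcons IHs /= cat_rcons signrN scaleNr.
Qed.

(** Exchanging the two blocks takes |s2| |s3| adjacent transpositions, and only the parity of that
    product matters. *)
Lemma alternating_catCA (V : lmodType K) (f : seq T -> V) s1 s2 s3 s4 :
  alternating f ->
  f (s1 ++ s2 ++ s3 ++ s4) =
    (-1) ^+ (odd (size s2) && odd (size s3)) *: f (s1 ++ s3 ++ s2 ++ s4).
Proof.
move=> f_alt; elim: s2 s1 => [|a s2 IHs] s1; first by rewrite scale1r.
rewrite cat_cons -cat_rcons IHs cat_rcons (alternating_cons_cat _ _ _ _ f_alt).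
rewrite scalerA -signr_addb; congr ((-1) ^+ (nat_of_bool _) *: _) => /=.
by case: (odd (size s2)); case: (odd _).
Qed.

Variables (eps : seq T -> int) (eps_or : orientation eps).

(** The cast to K allows [eps] to be paired by [alternating_scale] with coordinates and
    monomials. *)
Lemma orientation_alternating s t :
  alternating (fun u => (eps (s ++ u ++ t))%:~R : K).
Proof.
have [[eps0 epsN] _ _ _] := eps_or; split=> [u nu|s1 a s2 b s3].
  by rewrite eps0 // !cat_uniq (negPf nu) !andbF.
have E (x y : T) : s ++ (s1 ++ x :: s2 ++ y :: s3) ++ t =
  (s ++ s1) ++ x :: s2 ++ y :: (s3 ++ t).
  by rewrite -!catA cat_cons -catA.
by rewrite !E epsN mulrNz.
Qed.

Lemma orientation_alternating_catl s :
  alternating (fun u => (eps (s ++ u))%:~R : K).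
Proof.
have [f0 fN] := orientation_alternating s [::].
by split=> [u /f0|s1 a s2 b s3]; [|have := fN s1 a s2 b s3]; rewrite !cats0.
Qed.

Lemma orientation_sqr s : uniq s -> (eps s)%:~R * (eps s)%:~R = 1 :> K.
Proof.
have [_ + + _] := eps_or => /(_ s) s_val /(_ s) nz /nz {nz}.
by move: s_val; rewrite !inE => /or3P[] /eqP->; rewrite ?eqxx // ?mulrNN mulr1.
Qed.

End Signs.

(** * Contraction and deletion: linearity and action on monomials *)

Section ExtLinear.
Variables (K : fieldType) (T : finType).
Implicit Types (S : {set T}) (N x y : ext K T) (s t A B X : seq T).

Lemma pluckerD x y A : plucker (x + y) A = plucker x A + plucker y A.
Proof. by rewrite /plucker ffunE mulrDr. Qed.

Lemma plucker0 A : plucker (0 : ext K T) A = 0.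
Proof. by rewrite /plucker ffunE mulr0. Qed.

Lemma eq_plucker x y : (forall A, uniq A -> plucker x A = plucker y A) -> x = y.
Proof.
move=> eq_xy; have enumP (A : {set T}) : uniq (enum A) /\ enum A =i A.
  by split; [apply: enum_uniq|apply: mem_enum].
rewrite (ext_pluckerE x enumP) (ext_pluckerE y enumP).
by apply: eq_bigr => A _; rewrite eq_xy ?enum_uniq.
Qed.

Lemma ext_of_linear S (f1 f2 f : seq T -> K) (c : K) :
    (forall A, f A = c * f1 A + f2 A) ->
  ext_of S f = c *: ext_of S f1 + ext_of S f2.
Proof.
move=> fE; rewrite /ext_of scaler_sumr -big_split; apply: eq_bigr => A _ /=.
by rewrite fE scalerDl scalerA.
Qed.

Lemma contraction_linear c x y e :
  contraction (c *: x + y) e = c *: contraction x e + contraction y e.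
Proof. by apply: ext_of_linear => A; rewrite pluckerD pluckerZ. Qed.

Lemma contraction0 e : contraction (0 : ext K T) e = 0.
Proof. by rewrite /contraction /ext_of big1 // => A _; rewrite plucker0 scale0r. Qed.

Lemma contractionD x y e : contraction (x + y) e = contraction x e + contraction y e.
Proof. by rewrite -[x]scale1r contraction_linear !scale1r. Qed.

Lemma contractionZ c x e : contraction (c *: x) e = c *: contraction x e.
Proof. by rewrite -[_ *: x]addr0 contraction_linear contraction0 addr0. Qed.

Lemma deletion_linear c x y e :
  deletion (c *: x + y) e = c *: deletion x e + deletion y e.
Proof. by apply: ext_of_linear => A; rewrite pluckerD pluckerZ. Qed.

Lemma deletion0 e : deletion (0 : ext K T) e = 0.
Proof. by rewrite /deletion /ext_of big1 // => A _; rewrite plucker0 scale0r. Qed.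

Lemma deletionD x y e : deletion (x + y) e = deletion x e + deletion y e.
Proof. by rewrite -[x]scale1r deletion_linear !scale1r. Qed.

Lemma deletionZ c x e : deletion (c *: x) e = c *: deletion x e.
Proof. by rewrite -[_ *: x]addr0 deletion_linear deletion0 addr0. Qed.

Lemma contraction_seqD x y A :
  contraction_seq (x + y) A = contraction_seq x A + contraction_seq y A.
Proof. by elim: A => //= a A ->; rewrite contractionD. Qed.

Lemma contraction_seqZ c x A :
  contraction_seq (c *: x) A = c *: contraction_seq x A.
Proof. by elim: A => //= a A ->; rewrite contractionZ. Qed.

Lemma contraction_seq0 A : contraction_seq (0 : ext K T) A = 0.
Proof. by elim: A => //= a A ->; rewrite contraction0. Qed.

Lemma plucker_contraction_in x e B : e \in B -> plucker (contraction x e) B = 0.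
Proof.
move=> eB; apply: pluckerK_out; apply/subsetPn; exists e; first by rewrite inE.
by rewrite !inE eqxx.
Qed.

Lemma plucker_deletion_in x e B : e \in B -> plucker (deletion x e) B = 0.
Proof.
move=> eB; apply: pluckerK_out; apply/subsetPn; exists e; first by rewrite inE.
by rewrite !inE eqxx.
Qed.

(** On B, the two sides read the coordinates of x at B b a and B a b; when B contains a or b, or a =
    b, everything vanishes. *)
Lemma contraction_anti x a b :
  contraction (contraction x a) b = - contraction (contraction x b) a.
Proof.
have [<-|neab] := eqVneq a b.
  suff -> : contraction (contraction x a) a = 0 by rewrite oppr0.
  apply: eq_plucker => B _; rewrite plucker0.
  have [aB|aB] := boolP (a \in B); first by rewrite plucker_contraction_in.
  by rewrite plucker_contraction // plucker_contraction_in // mem_rcons mem_head.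
apply: eq_plucker => B _; rewrite -scaleN1r pluckerZ mulN1r.
have [aB|aB] := boolP (a \in B); have [bB|bB] := boolP (b \in B).
- by rewrite !plucker_contraction_in ?oppr0.
- rewrite plucker_contraction // plucker_contraction_in ?mem_rcons ?inE ?aB ?orbT //.
  by rewrite plucker_contraction_in ?oppr0.
- rewrite plucker_contraction_in // plucker_contraction //.
  by rewrite plucker_contraction_in ?oppr0 // mem_rcons inE bB orbT.
rewrite !plucker_contraction ?mem_rcons ?inE ?negb_or ?neab ?(eq_sym b) ?neab //.
have [_ /(_ B b [::] a [::])] := plucker_alternating x.
by rewrite -!cats1 -!catA.
Qed.

(** Contractions anticommute, so a reordering multiplies both factors by the same sign. With f built
    from [eps], this controls the dependence on the order of E. *)
Lemma contraction_seq_perm (T' : eqType) (h : T' -> T) (f : seq T' -> K) x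
    (s t : seq T') :
    alternating f -> perm_eq s t ->
  f s *: contraction_seq x (map h s) = f t *: contraction_seq x (map h t).
Proof.
move=> [_ fN]; pose F u := f u *: contraction_seq x (map h u).
apply: (perm_eq_adj (F := F)) => s1 a b s2.
rewrite /F (fN s1 a [::] b s2) scaleNr -scalerN; congr (_ *: _).
rewrite /contraction_seq !map_cat !foldr_cat /= contraction_anti.
set y := contraction _ (h b); rewrite -[- y]scaleN1r.
rewrite -[foldr _ (-1 *: y) _]/(contraction_seq (-1 *: y) (map h s1)).
by rewrite contraction_seqZ scaleN1r opprK.
Qed.

Lemma contraction_mon e B : e \notin B -> contraction (ext_mon K B) e = 0.
Proof.
move=> eB; apply: eq_plucker => C uC; rewrite plucker0.
have [eC|eC] := boolP (e \in C); first by rewrite plucker_contraction_in.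
have [uB|nuB] := boolP (uniq B); last first.
  rewrite (alternating_mon K T).1 // contraction0; exact: plucker0.
rewrite plucker_contraction // plucker_mon_neq ?rcons_uniq ?eC //.
by apply: contra eB => /perm_mem->; rewrite mem_rcons mem_head.
Qed.

Lemma contraction_mon_rcons e B :
  e \notin B -> contraction (ext_mon K (rcons B e)) e = ext_mon K B.
Proof.
move=> eB; have [uB|nuB] := boolP (uniq B); last first.
  by rewrite !(alternating_mon K T).1 ?contraction0 // rcons_uniq eB.
have uBe : uniq (rcons B e) by rewrite rcons_uniq eB.
apply: eq_plucker => C uC.
have [eC|eC] := boolP (e \in C).
  rewrite plucker_contraction_in // plucker_mon_neq //.
  by apply: contra eB => /perm_mem->.
have uCe : uniq (rcons C e) by rewrite rcons_uniq eC.
have [pBC|npBC] := boolP (perm_eq B C); last first.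
  by rewrite plucker_contraction // !plucker_mon_neq // -!cats1 perm_cat2r.
have cB := plucker_contraction (ext_mon K (rcons B e)) eB.
set z := contraction _ e in cB *.
(* The coordinate of B at C is a sign m with m m = 1, and m z[C] = z[B] = 1; hence z[C] = m. *)
have := plucker_mon_perm (V := K^o) (plucker_alternating z) uB pBC.
have := plucker_mon_perm (V := K^o) (plucker_alternating (ext_mon K B)) uB pBC.
rewrite cB !plucker_mon_id ?rcons_uniq ?eB // => p2 pc.
rewrite -[LHS]mul1r -[X in X * _]p2 -[in RHS](mulr1 (plucker _ C)) -[in RHS]pc.
by rewrite -mulrA.
Qed.

Lemma deletion_mon e B : e \notin B -> deletion (ext_mon K B) e = ext_mon K B.
Proof.
move=> eB; apply: eq_plucker => C uC.
have [eC|eC] := boolP (e \in C); last by rewrite plucker_deletion.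
rewrite plucker_deletion_in //.
have [uB|nuB] := boolP (uniq B); last by rewrite (alternating_mon K T).1 ?plucker0.
by rewrite plucker_mon_neq //; apply: contra eB => /perm_mem->.
Qed.

Lemma deletion_mon_rcons e B : deletion (ext_mon K (rcons B e)) e = 0.
Proof.
have [uB|nuB] := boolP (uniq (rcons B e)); last first.
  by rewrite (alternating_mon K T).1 ?deletion0.
apply: eq_plucker => C uC; rewrite plucker0.
have [eC|eC] := boolP (e \in C); first by rewrite plucker_deletion_in.
rewrite plucker_deletion // plucker_mon_neq //.
by apply: contra eC => /perm_mem<-; rewrite mem_rcons mem_head.
Qed.

End ExtLinear.

(** * Elements of given parity, and contraction of their products *)

Section Homogeneous.
Variable K : fieldType.

(* The part of parity [b] of the exterior algebra over [K S]: every sign below *)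
(* depends on degrees modulo 2 only.                                           *)
Inductive homog (T : finType) (S : {set T}) (b : bool) : ext K T -> Prop :=
| homog0 : homog S b 0
| homogD x y : homog S b x -> homog S b y -> homog S b (x + y)
| homogZ c x : homog S b x -> homog S b (c *: x)
| homog_mon_uniq s : uniq s -> {subset s <= S} -> odd (size s) = b ->
    homog S b (ext_mon K s).

Section OneGroundSet.
Variable T : finType.
Implicit Types (S : {set T}) (x y N : ext K T) (s t A B X : seq T) (b : bool).

Lemma homog_mon S b s : {subset s <= S} -> odd (size s) = b ->
  homog S b (ext_mon K s).
Proof.
have [us|nus] := boolP (uniq s); first exact: homog_mon_uniq.
by rewrite (alternating_mon K T).1 // => *; apply: homog0.
Qed.

Lemma homog_sub S S' b x : S \subset S' -> homog S b x -> homog S' b x.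
Proof.
move=> /subsetP sSS'; elim=> [|u v _ IHu _ IHv|c u _ IHu|s us sS ps].
- exact: homog0.
- exact: homogD.
- exact: homogZ.
- by apply: homog_mon => // a /sS /sSS'.
Qed.

Lemma homog_gen S a : a \in S -> homog S true (ext_gen K a).
Proof.
move=> aS; have -> : ext_gen K a = ext_mon K [:: a] by rewrite /ext_mon big_seq1.
by apply: homog_mon => // b; rewrite inE => /eqP->.
Qed.

Lemma homogM S b1 b2 x y : homog S b1 x -> homog S b2 y ->
  homog S (b1 (+) b2) (x * y).
Proof.
move=> Hx Hy; elim: Hx => [|u v _ IHu _ IHv|c u _ IHu|s us sS ps].
- by rewrite mul0r; apply: homog0.
- by rewrite mulrDl; apply: homogD.
- by rewrite -scalerAl; apply: homogZ.
elim: Hy => [|u v _ IHu _ IHv|c u _ IHu|t ut tS pt].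
- by rewrite mulr0; apply: homog0.
- by rewrite mulrDr; apply: homogD.
- by rewrite -scalerAr; apply: homogZ.
rewrite -ext_monM; apply: homog_mon; last by rewrite size_cat oddD ps pt.
by move=> a; rewrite mem_cat => /orP[/sS|/tS].
Qed.

Lemma homog_prod (I : eqType) S (s : seq I) (F : I -> ext K T) :
  {in s, forall i, homog S true (F i)} -> homog S (odd (size s)) (\prod_(i <- s) F i).
Proof.
elim: s => [|i s IHs] Fs.
  by have := @homog_mon S false [::]; rewrite /ext_mon !big_nil; apply.
rewrite big_cons -[odd _]/(true (+) odd (size s)); apply: homogM.
  by apply: Fs; rewrite mem_head.
by apply: IHs => j js; apply: Fs; rewrite inE js orbT.
Qed.

(** Vectors are odd and scalars even. This is what being an extensor contributes to the sign
    computations. *)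
Lemma homog_extensor S N : extensor S N -> exists b, homog S b N.
Proof.
case=> [[c ->]|[vs vsS ->]].
  exists false; apply: homogZ.
  by have := @homog_mon S false [::]; rewrite /ext_mon big_nil; apply.
exists (odd (size vs)); apply: homog_prod => v /vsS[c ->].
elim/big_rec: _ => [|a y aS Hy]; first exact: homog0.
by apply: homogD => //; apply/homogZ/homog_gen.
Qed.

Lemma homog_comm S b1 b2 x y : homog S b1 x -> homog S b2 y ->
  x * y = (-1) ^+ (b1 && b2) *: (y * x).
Proof.
move=> Hx Hy; elim: Hx => [|u v _ IHu _ IHv|c u _ IHu|s us sS ps].
- by rewrite mul0r mulr0 scaler0.
- by rewrite mulrDl mulrDr scalerDr IHu IHv.
- by rewrite -scalerAl IHu -scalerAr !scalerA mulrC.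
elim: Hy => [|u v _ IHu _ IHv|c u _ IHu|t ut tS pt].
- by rewrite mul0r mulr0 scaler0.
- by rewrite mulrDl mulrDr scalerDr IHu IHv.
- by rewrite -scalerAr IHu -scalerAl !scalerA mulrC.
rewrite -!ext_monM -ps -pt -[in LHS](cats0 t).
by rewrite (alternating_catCA [::] s t [::] (alternating_mon K T)) /= !cats0.
Qed.

Lemma ext_mon_rcons s e : ext_mon K (rcons s e) = ext_mon K s * ext_gen K e.
Proof. by rewrite -cats1 ext_monM {2}/ext_mon big_seq1. Qed.

(** Expansion along e: u turns out to be the deletion and v the contraction of x ([deletion_split],
    [contraction_split]). *)
Lemma homog_split S b e x : homog S b x -> exists u v,
  [/\ homog (S :\ e) b u, homog (S :\ e) (~~ b) v & x = u + v * ext_gen K e].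
Proof.
elim=> [|x1 x2 _ [u1 [v1 [Hu1 Hv1 ->]]] _ [u2 [v2 [Hu2 Hv2 ->]]]
  |c x1 _ [u [v [Hu Hv ->]]]|s us sS ps].
- by exists 0, 0; split; rewrite ?mul0r ?addr0 //; apply: homog0.
- exists (u1 + u2), (v1 + v2); split; try exact: homogD.
  by rewrite mulrDl addrACA.
- exists (c *: u), (c *: v); split; try exact: homogZ.
  by rewrite scalerDr scalerAl.
have [es|es] := boolP (e \in s); last first.
  exists (ext_mon K s), 0; split; [|exact: homog0|by rewrite mul0r addr0].
  apply: homog_mon => // a as_; rewrite !inE sS // andbT.
  by apply: contraNneq es => <-.
have pse : perm_eq (rcons (rem e s) e) s.
  by rewrite perm_rcons perm_sym perm_to_rem.
have use : uniq (rcons (rem e s) e) by rewrite (perm_uniq pse).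
(* The coefficient is the sign of moving e to the end of s. *)
exists 0, (plucker (ext_mon K s) (rcons (rem e s) e) *: ext_mon K (rem e s)).
split; first exact: homog0.
  apply: homogZ; apply: homog_mon => [a|]; last first.
    by rewrite size_rem // -ps; case: (s) es => // *; rewrite negbK.
  by rewrite mem_rem_uniq // !inE => /andP[-> /sS].
rewrite add0r -scalerAl -ext_mon_rcons.
by rewrite (plucker_mon_perm (alternating_mon K T)) // perm_sym.
Qed.

Lemma contraction_homog0 S b e x : e \notin S -> homog S b x -> contraction x e = 0.
Proof.
move=> eS; elim=> [|u v _ IHu _ IHv|c u _ IHu|s us sS ps].
- exact: contraction0.
- by rewrite contractionD IHu IHv addr0.
- by rewrite contractionZ IHu scaler0.
- by rewrite contraction_mon //; apply: contra eS => /sS.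
Qed.

Lemma deletion_homog S b e x : e \notin S -> homog S b x -> deletion x e = x.
Proof.
move=> eS; elim=> [|u v _ IHu _ IHv|c u _ IHu|s us sS ps].
- exact: deletion0.
- by rewrite deletionD IHu IHv.
- by rewrite deletionZ IHu.
- by rewrite deletion_mon //; apply: contra eS => /sS.
Qed.

Lemma contraction_mul_gen S b e x :
  e \notin S -> homog S b x -> contraction (x * ext_gen K e) e = x.
Proof.
move=> eS; elim=> [|u v _ IHu _ IHv|c u _ IHu|s us sS ps].
- by rewrite mul0r contraction0.
- by rewrite mulrDl contractionD IHu IHv.
- by rewrite -scalerAl contractionZ IHu.
by rewrite -ext_mon_rcons contraction_mon_rcons //; apply: contra eS => /sS.
Qed.

Lemma deletion_mul_gen S b e x :
  homog S b x -> deletion (x * ext_gen K e) e = 0.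
Proof.
elim=> [|u v _ IHu _ IHv|c u _ IHu|s us sS ps].
- by rewrite mul0r deletion0.
- by rewrite mulrDl deletionD IHu IHv addr0.
- by rewrite -scalerAl deletionZ IHu scaler0.
by rewrite -ext_mon_rcons deletion_mon_rcons.
Qed.

Lemma contraction_split S b1 b2 e u v : e \notin S -> homog S b1 u -> homog S b2 v ->
  contraction (u + v * ext_gen K e) e = v.
Proof.
move=> eS Hu Hv; rewrite contractionD (contraction_homog0 eS Hu).
by rewrite (contraction_mul_gen eS Hv) add0r.
Qed.

Lemma deletion_split S b1 b2 e u v : e \notin S -> homog S b1 u -> homog S b2 v ->
  deletion (u + v * ext_gen K e) e = u.
Proof.
move=> eS Hu Hv; rewrite deletionD (deletion_homog eS Hu).
by rewrite (deletion_mul_gen e Hv) addr0.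
Qed.

Lemma homog_contraction S b e x :
  homog S b x -> homog (S :\ e) (~~ b) (contraction x e).
Proof.
move=> /(homog_split e)[u [v [Hu Hv ->]]].
by rewrite (contraction_split _ Hu Hv) // !inE eqxx.
Qed.

Lemma homog_contraction_seq S b A x : homog S b x ->
  homog (S :\: [set:: A]) (b (+) odd (size A)) (contraction_seq x A).
Proof.
move=> Hx; elim: A => [|a A IHA] /=.
  by rewrite addbF; apply: homog_sub Hx; apply/subsetP=> y yS; rewrite !inE yS.
have := homog_contraction a IHA; rewrite addbN; apply: homog_sub.
by apply/subsetP=> y; rewrite !inE negb_or andbA.
Qed.

Lemma contraction_mulr S b1 b2 e x y : e \notin S ->
  homog S b1 x -> homog [set: T] b2 y -> contraction (x * y) e = x * contraction y e.
Proof.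
move=> eS Hx /(homog_split e)[u [v [Hu Hv ->]]].
have e_out : e \notin [set: T] :\ e by rewrite !inE eqxx.
have {}Hx : homog ([set: T] :\ e) b1 x.
  apply: homog_sub Hx; apply/subsetP=> a aS; rewrite !inE andbT.
  by apply: contraNneq eS => <-.
rewrite (contraction_split e_out Hu Hv) mulrDr mulrA.
by rewrite (contraction_split e_out (homogM Hx Hu) (homogM Hx Hv)).
Qed.

(** The e to be stripped lies in x and must first be moved to the right past y, of parity [b2]. *)
Lemma contraction_mull S b1 b2 e x y : e \notin S ->
    homog [set: T] b1 x -> homog S b2 y ->
  contraction (x * y) e = (-1) ^+ b2 *: (contraction x e * y).
Proof.
move=> eS /(homog_split e)[u [v [Hu Hv ->]]] Hy.
have e_out : e \notin [set: T] :\ e by rewrite !inE eqxx.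
rewrite (contraction_split e_out Hu Hv) mulrDl -mulrA.
rewrite (homog_comm (homog_gen (in_setT e)) (homog_sub (subsetT S) Hy)) /=.
have {}Hy : homog ([set: T] :\ e) b2 y.
  apply: homog_sub Hy; apply/subsetP=> a aS; rewrite !inE andbT.
  by apply: contraNneq eS => <-.
rewrite -scalerAr mulrA scalerAl.
by rewrite (contraction_split e_out (homogM Hu Hy) (homogZ _ (homogM Hv Hy))).
Qed.

Lemma contraction_seq_mulr S b1 b2 A x y : {in A, forall e, e \notin S} ->
    homog S b1 x -> homog [set: T] b2 y ->
  contraction_seq (x * y) A = x * contraction_seq y A.
Proof.
move=> + Hx Hy; elim: A => //= e A IHA AS.
rewrite IHA => [|a aA]; last by apply: AS; rewrite inE aA orbT.
have HA := homog_sub (subsetT _) (homog_contraction_seq A Hy).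
by rewrite (contraction_mulr _ Hx HA) // AS ?mem_head.
Qed.

Lemma contraction_seq_mull S b1 b2 A x y : {in A, forall e, e \notin S} ->
    homog [set: T] b1 x -> homog S b2 y ->
  contraction_seq (x * y) A =
    (-1) ^+ (odd (size A) && b2) *: (contraction_seq x A * y).
Proof.
move=> + Hx Hy; elim: A => [|e A IHA] AS /=; first by rewrite scale1r.
rewrite IHA => [|a aA]; last by apply: AS; rewrite inE aA orbT.
have HA := homog_sub (subsetT _) (homog_contraction_seq A Hx).
rewrite contractionZ (contraction_mull _ HA Hy) ?AS ?mem_head //.
rewrite scalerA -signr_addb; congr ((-1) ^+ (nat_of_bool _) *: _).
by case: (odd (size A)); case: b2 {Hy IHA}.
Qed.

(** * The canonical dual: monomials, products, and one extra element *)

Section Dual.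
Variables (eps : seq T -> int) (eps_or : orientation eps).

Lemma dual_linear S c x y :
  dual eps S (c *: x + y) = c *: dual eps S x + dual eps S y.
Proof.
by apply: ext_of_linear => A /=; rewrite pluckerD pluckerZ mulrDl mulrA.
Qed.

Lemma dual0 S : dual eps S (0 : ext K T) = 0.
Proof.
rewrite /dual /ext_of big1 // => A _.
by rewrite plucker0 mul0r scale0r.
Qed.

Lemma dualD S x y : dual eps S (x + y) = dual eps S x + dual eps S y.
Proof. by rewrite -[x]scale1r dual_linear !scale1r. Qed.

Lemma dualZ S c x : dual eps S (c *: x) = c *: dual eps S x.
Proof. by rewrite -[_ *: x]addr0 dual_linear dual0 addr0. Qed.

(** Only the summand indexed by the set of X survives. Replacing the enumerations in the definition
    by A and X is harmless, since each sequence occurs in two alternating factors. *)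
Lemma dual_mon S A X : uniq (A ++ X) -> A ++ X =i S ->
  dual eps S (ext_mon K A) = (eps (A ++ X))%:~R *: ext_mon K X.
Proof.
move=> uAX AXS; have [uA /hasPn AX uX] := and3P (etrans (esym (cat_uniq _ _)) uAX).
have enumSX : perm_eq A (enum (S :\: [set:: X])).
  apply: uniq_perm => // [|a]; first exact: enum_uniq.
  rewrite mem_enum !inE -AXS mem_cat; case: (boolP (a \in X)) => [/AX/negPf->|] //.
  by rewrite orbF.
have perm_X : perm_eq (enum [set:: X]) X.
  by apply: uniq_perm; rewrite ?enum_uniq // => a; rewrite mem_enum inE.
have setK (Y : {set T}) : [set:: enum Y] = Y.
  by apply/setP=> a; rewrite inE mem_enum.
have XS : [set:: X] \subset S.
  by apply/subsetP=> a; rewrite inE -AXS mem_cat orbC => ->.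
rewrite /dual /ext_of (bigD1 [set:: X]) //= [X in _ + X]big1 ?addr0 => [|Y].
  have altA := orientation_alternating_catl K eps_or A.
  have altX := orientation_alternating K eps_or [::] (enum [set:: X]).
  rewrite -(alternating_scale altA (alternating_mon K T) perm_X) setK.
  congr (_ *: _).
  exact: (plucker_mon_perm (V := K^o) altX uA enumSX).
move=> /andP[YS neYX]; rewrite plucker_mon_neq ?mul0r ?scale0r ?enum_uniq //.
apply: contraNN neYX => pAY; apply/eqP/setP=> a; rewrite inE.
have := perm_mem pAY a; rewrite setK mem_enum !inE.
have := AXS a; rewrite mem_cat; have := subsetP YS a.
case: (a \in Y) => [/(_ isT)->|_]; case: (boolP (a \in X)) => // aX.
- by rewrite orbF => ->.
- by rewrite orbT => <-; rewrite (negPf (AX _ aX)).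
Qed.

Lemma complement_seq S A : uniq A -> {subset A <= S} ->
  exists X, [/\ uniq (A ++ X), A ++ X =i S & odd (size X) = odd #|S| (+) odd (size A)].
Proof.
move=> uA sAS; exists (enum (S :\: [set:: A])).
have uAX : uniq (A ++ enum (S :\: [set:: A])).
  rewrite cat_uniq uA enum_uniq andbT; apply/hasPn=> a.
  by rewrite mem_enum !inE => /andP[].
have AXS : A ++ enum (S :\: [set:: A]) =i S.
  move=> a; rewrite mem_cat mem_enum !inE.
  by case: (boolP (a \in A)) => // /sAS->.
split=> //; have <- : size (A ++ enum (S :\: [set:: A])) = #|S|.
  by rewrite -(card_uniqP uAX); apply: eq_card.
by rewrite size_cat oddD addbC addbA addbb.
Qed.

Lemma homog_dual S b x : homog S b x -> homog S (odd #|S| (+) b) (dual eps S x).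
Proof.
elim=> [|u v _ IHu _ IHv|c u _ IHu|s us sS ps].
- by rewrite dual0; apply: homog0.
- by rewrite dualD; apply: homogD.
- by rewrite dualZ; apply: homogZ.
have [X [usX sXS oX]] := complement_seq us sS.
rewrite (dual_mon usX sXS); apply/homogZ/homog_mon; last by rewrite -ps.
by move=> a aX; rewrite -sXS mem_cat aX orbT.
Qed.

(** Each sequence occurs in two [eps] factors, so the signs of its reordering cancel. *)
Lemma orientation_cat_perm s1 s2 t1 t2 : perm_eq s1 t1 -> perm_eq s2 t2 ->
  (eps (s1 ++ s2) * eps s1 * eps s2)%:~R = (eps (t1 ++ t2) * eps t1 * eps t2)%:~R :> K.
Proof.
move=> p1 p2; rewrite !intrM.
have alt := orientation_alternating_catl K eps_or [::].
have := alternating_scale (V := K^o) (orientation_alternating K eps_or [::] s2) alt p1.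
have := alternating_scale (V := K^o) (orientation_alternating_catl K eps_or t1) alt p2.
rewrite /= => e2 e1; transitivity ((eps (t1 ++ s2))%:~R * (eps t1)%:~R * (eps s2)%:~R : K).
  by congr (_ * _).
by rewrite mulrAC [RHS]mulrAC; congr (_ * _).
Qed.

(** For monomials s and t with complements X and Y, eps(s t X Y) is compared with eps(s X) eps(t Y).
    The power of -1 comes from moving t past X, whose parity is |S1| + b1. *)
Lemma dual_mul S1 S2 s1 s2 b1 b2 x y :
    uniq (s1 ++ s2) -> s1 =i S1 -> s2 =i S2 -> homog S1 b1 x -> homog S2 b2 y ->
  dual eps (S1 :|: S2) (x * y) =
    ((eps (s1 ++ s2) * eps s1 * eps s2)%:~R * (-1) ^+ (b2 && (odd #|S1| (+) b1)))
      *: (dual eps S1 x * dual eps S2 y).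
Proof.
move=> us s1E s2E Hx Hy; set c := (X in X *: _).
have [us1 s12 us2] := and3P (etrans (esym (cat_uniq _ _)) us).
elim: Hx => [|u v _ IHu _ IHv|d u _ IHu|s uns sS ps].
- by rewrite mul0r !dual0 mul0r scaler0.
- by rewrite mulrDl !dualD mulrDl scalerDr IHu IHv.
- by rewrite -scalerAl !dualZ -scalerAl IHu !scalerA mulrC.
elim: Hy => [|u v _ IHu _ IHv|d u _ IHu|t ut tS pt].
- by rewrite mulr0 !dual0 mulr0 scaler0.
- by rewrite mulrDr !dualD mulrDr scalerDr IHu IHv.
- by rewrite -scalerAr !dualZ -scalerAr IHu !scalerA mulrC.
have [X [usX sXS oX]] := complement_seq uns sS.
have [Y [utY tYS oY]] := complement_seq ut tS.
have p1 : perm_eq s1 (s ++ X) by apply: uniq_perm => // a; rewrite s1E sXS.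
have p2 : perm_eq s2 (t ++ Y) by apply: uniq_perm => // a; rewrite s2E tYS.
have p12 : perm_eq (s1 ++ s2) ((s ++ t) ++ (X ++ Y)).
  apply: perm_trans (perm_cat p1 p2) _.
  by rewrite -!catA perm_cat2l perm_catCA.
have uAll : uniq ((s ++ t) ++ (X ++ Y)) by rewrite -(perm_uniq p12).
rewrite -ext_monM (dual_mon uAll) => [|a]; last first.
  by rewrite -(perm_mem p12) mem_cat s1E s2E inE.
rewrite (dual_mon usX sXS) (dual_mon utY tYS) -scalerAl -scalerAr !scalerA.
rewrite -ext_monM; congr (_ *: _); rewrite /c (orientation_cat_perm p1 p2) !intrM.
have -> : (s ++ t) ++ X ++ Y = s ++ t ++ X ++ Y by rewrite catA.
have := alternating_catCA s t X Y (V := K^o) (orientation_alternating_catl K eps_or [::]).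
rewrite /= => ->; rewrite -[_ *: _]/(_ * _) -pt -ps -oX -(catA s X).
have := orientation_sqr K eps_or usX; have := orientation_sqr K eps_or utY.
set u := (eps (s ++ X))%:~R; set v := (eps (t ++ Y))%:~R.
set w := (eps (s ++ _))%:~R; set z := _ ^+ _ => v2 u2.
(* On the right, eps(s X) and eps(t Y) each occur twice: from the reordering of s1 and s2, and from
   the two duals. *)
transitivity (z * w * (u * u) * (v * v)); first by rewrite u2 v2 !mulr1.
ring.
Qed.

Lemma orientation_rcons_perm s t e : perm_eq s t ->
  (eps (rcons s e) * eps s)%:~R = (eps (rcons t e) * eps t)%:~R :> K.
Proof.
move=> pst; have alt := orientation_alternating_catl K eps_or [::].
have := alternating_scale (V := K^o) (orientation_alternating K eps_or [::] [:: e]) alt pst.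
by rewrite !intrM -!cats1.
Qed.

Section DualExtend.
Variables (S : {set T}) (s0 : seq T) (e : T).
Hypotheses (us0 : uniq (rcons s0 e)) (s0E : s0 =i S).
Let c : K := (eps (rcons s0 e) * eps s0)%:~R.

Let eNS : e \notin S.
Proof. by move: us0; rewrite rcons_uniq s0E => /andP[]. Qed.

Let c_complement s X : uniq (s ++ X) -> s ++ X =i S ->
  (eps (s ++ rcons X e))%:~R = c * (eps (s ++ X))%:~R.
Proof.
move=> usX sXS; have us : uniq s0 by move: us0; rewrite rcons_uniq => /andP[].
have pX : perm_eq s0 (s ++ X) by apply: uniq_perm => // a; rewrite s0E sXS.
rewrite /c (orientation_rcons_perm e pX) intrM -mulrA (orientation_sqr K eps_or usX).
by rewrite mulr1 rcons_cat.
Qed.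

Let complement_rcons s X : uniq (s ++ X) -> s ++ X =i S ->
  uniq (s ++ rcons X e) /\ s ++ rcons X e =i e |: S.
Proof.
move=> usX sXS; rewrite -rcons_cat rcons_uniq usX sXS eNS; split=> // a.
by rewrite mem_rcons !inE sXS.
Qed.

(** The new element e joins the complement X of each monomial, at its end. *)
Lemma dual_extend b x : homog S b x ->
  dual eps (e |: S) x = c *: (dual eps S x * ext_gen K e).
Proof.
elim=> [|u v _ IHu _ IHv|d u _ IHu|s us sS ps].
- by rewrite !dual0 mul0r scaler0.
- by rewrite !dualD mulrDl scalerDr IHu IHv.
- by rewrite !dualZ -scalerAl IHu !scalerA mulrC.
have [X [usX sXS oX]] := complement_seq us sS.
have [usXe sXSe] := complement_rcons usX sXS.
rewrite (dual_mon usXe sXSe) (dual_mon usX sXS) (c_complement usX sXS).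
by rewrite -scalerAl scalerA ext_mon_rcons.
Qed.

(** Here e stays out of the complement: the sign is that of moving e past X in s e X, X having
    parity |S| + b. *)
Lemma dual_extend_mul_gen b x : homog S b x ->
  dual eps (e |: S) (x * ext_gen K e) =
    (c * (-1) ^+ (odd #|S| (+) b)) *: dual eps S x.
Proof.
elim=> [|u v _ IHu _ IHv|d u _ IHu|s us sS ps].
- by rewrite mul0r !dual0 scaler0.
- by rewrite mulrDl !dualD scalerDr IHu IHv.
- by rewrite -scalerAl !dualZ IHu !scalerA mulrC.
have [X [usX sXS oX]] := complement_seq us sS.
have [usXe sXSe] := complement_rcons usX sXS.
have pX : perm_eq (s ++ rcons X e) (rcons s e ++ X).
  by rewrite cat_rcons perm_cat2l perm_rcons.
rewrite -ext_mon_rcons (dual_mon (A := rcons s e) (X := X)) => [||a]; last 2 first.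
- by rewrite -(perm_uniq pX).
- by rewrite -(perm_mem pX).
rewrite (dual_mon usX sXS) scalerA -ps -oX cat_rcons; congr (_ *: _).
have := alternating_cons_cat s e X [::] (V := K^o) (orientation_alternating_catl K eps_or [::]).
rewrite /= cats0 => ->; rewrite cats1 (c_complement usX sXS) -[_ *: _]/(_ * _).
by rewrite mulrCA mulrA.
Qed.

End DualExtend.

End Dual.

End OneGroundSet.

(** * Induced homomorphisms on elements supported in a subset *)

Section Lift.
Variables (T T' : finType).
Implicit Types (S : {set T}) (f : T -> ext K T').

Lemma eq_ext_lift S b f f' x :
    (forall a, is_vector [set: T'] (f a)) -> (forall a, is_vector [set: T'] (f' a)) ->
    {in S, f =1 f'} -> homog S b x -> ext_lift f x = ext_lift f' x.
Proof.
move=> fv fv' eqf; elim=> [|u v _ IHu _ IHv|c u _ IHu|s us sS ps].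
- by rewrite !raddf0.
- by rewrite !raddfD /= IHu IHv.
- by rewrite !linearZ /= IHu.
rewrite (ext_lift_mon fv) (ext_lift_mon fv') !big_seq.
by apply: eq_bigr => a /sS /eqf.
Qed.

Lemma homog_ext_lift S (S' : {set T'}) b f x :
    (forall a, is_vector [set: T'] (f a)) -> {in S, forall a, homog S' true (f a)} ->
  homog S b x -> homog S' b (ext_lift f x).
Proof.
move=> fv fS; elim=> [|u v _ IHu _ IHv|c u _ IHu|s us sS ps].
- by rewrite raddf0; apply: homog0.
- by rewrite raddfD; apply: homogD.
- by rewrite linearZ; apply: homogZ.
by rewrite (ext_lift_mon fv) -ps; apply: homog_prod => a /sS /fS.
Qed.

End Lift.

End Homogeneous.

(** * Ported extensors: products, recursion on a non-port element, and the case of ports only *)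

Section PortedTheory.
Variables (K : fieldType) (U : finType).
Variables (g r : U -> K) (eps : seq U -> int) (eps_or : orientation eps).
Implicit Types (P E A B I V : seq U) (x y N : ext K U).

(** The ground set of M(N). Locating M(N) there shows which non-port elements it avoids. *)
Definition split_ports P E : {set U + U + U} :=
  [set w | match w with
           | inl (inl p) => p \in P
           | inl (inr p) => p \in P
           | inr e => e \in E
           end].

Lemma homog_iota P E b x : homog [set:: P ++ E] b x ->
  homog (split_ports P E) b (iota_g g P x).
Proof.
apply: homog_ext_lift (iota_gen_vector g P) _ => a; rewrite inE mem_cat /iota_gen.
by case: ifP => aP /= aE; [|apply: homogZ]; apply: homog_gen; rewrite inE.
Qed.

Lemma homog_upsilon P E b x : homog [set:: P ++ E] b x ->
  homog (split_ports P E) b (upsilon_r r P x).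
Proof.
apply: homog_ext_lift (upsilon_gen_vector r P) _ => a; rewrite inE mem_cat /upsilon_gen.
by case: ifP => aP /= aE; [|apply: homogZ]; apply: homog_gen; rewrite inE.
Qed.

(** The ports only tell which generators are renamed rather than weighted; P and P' agree on this
    over P' and E because P avoids E. *)
Lemma iota_g_sub P P' E b x : {subset P' <= P} -> [disjoint P & E] ->
  homog [set:: P' ++ E] b x -> iota_g g P x = iota_g g P' x.
Proof.
move=> sP dPE; apply: eq_ext_lift (iota_gen_vector g P) (iota_gen_vector g P') _ => a.
rewrite inE mem_cat /iota_gen; case: (boolP (a \in P')) => [/sP->//|_] /= aE.
by rewrite (disjointFl dPE aE).
Qed.

Lemma upsilon_r_sub P P' E b x : {subset P' <= P} -> [disjoint P & E] ->
  homog [set:: P' ++ E] b x -> upsilon_r r P x = upsilon_r r P' x.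
Proof.
move=> sP dPE.
apply: eq_ext_lift (upsilon_gen_vector r P) (upsilon_gen_vector r P') _ => a.
rewrite inE mem_cat /upsilon_gen; case: (boolP (a \in P')) => [/sP->//|_] /= aE.
by rewrite (disjointFl dPE aE).
Qed.

Lemma iota_g_mon P A : {subset A <= P} ->
  iota_g g P (ext_mon K A) = ext_mon K (map (@port_iota U) A).
Proof.
move=> sAP; rewrite /iota_g (ext_lift_mon (iota_gen_vector g P)) /ext_mon big_map.
by rewrite !big_seq; apply: eq_bigr => a /sAP aP; rewrite /iota_gen aP.
Qed.

Lemma upsilon_r_mon P A : {subset A <= P} ->
  upsilon_r r P (ext_mon K A) = ext_mon K (map (@port_upsilon U) A).
Proof.
move=> sAP; rewrite /upsilon_r (ext_lift_mon (upsilon_gen_vector r P)) /ext_mon big_map.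
by rewrite !big_seq; apply: eq_bigr => a /sAP aP; rewrite /upsilon_gen aP.
Qed.

Lemma odd_card_seq (s : seq U) : uniq s -> odd #|[set:: s]| = odd (size s).
Proof. by move=> us; rewrite cardsE (card_uniqP us). Qed.

(** N has parity b and its dual |S| + b, so the parity of M(N) is |S|, whatever b is. *)
Lemma homog_ext_M P E b N : homog [set:: P ++ E] b N -> uniq (P ++ E) ->
  homog (split_ports P E) (odd (size (P ++ E))) (ext_M eps g r P E N).
Proof.
move=> HN uPE; have := homogM (homog_iota HN) (homog_upsilon (homog_dual eps_or HN)).
by rewrite odd_card_seq // addbC -addbA addbb addbF.
Qed.

Lemma ext_ME_perm P E E' N : uniq (P ++ E) -> perm_eq E E' ->
  ext_ME eps g r P E N = (eps (P ++ E) * eps (P ++ E'))%:~R *: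
    contraction_seq (ext_M eps g r P E N) (map (@nonport U) E').
Proof.
move=> uPE pE; rewrite /ext_ME intrM -scalerA.
rewrite -(contraction_seq_perm _ _ (orientation_alternating_catl K eps_or P) pE).
by rewrite scalerA (orientation_sqr K eps_or uPE) scale1r.
Qed.

Lemma ext_M_mul P1 E1 P2 E2 P E b1 b2 N1 N2 :
    uniq ((P1 ++ E1) ++ (P2 ++ E2)) -> perm_eq P (P1 ++ P2) -> perm_eq E (E1 ++ E2) ->
    homog [set:: P1 ++ E1] b1 N1 -> homog [set:: P2 ++ E2] b2 N2 ->
  ext_M eps g r P E (N1 * N2) =
    (eps ((P1 ++ E1) ++ (P2 ++ E2)) * eps (P1 ++ E1) * eps (P2 ++ E2))%:~R
      *: (ext_M eps g r P1 E1 N1 * ext_M eps g r P2 E2 N2).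
Proof.
move=> uPE pP pE H1 H2.
have H1' := homog_dual eps_or H1; have H2' := homog_dual eps_or H2.
have perm_all : perm_eq ((P1 ++ E1) ++ (P2 ++ E2)) (P ++ E).
  rewrite perm_sym; apply: perm_trans (perm_cat pP pE) _.
  by rewrite -!catA perm_cat2l perm_catCA.
have dPE : [disjoint P & E].
  rewrite disjoint_has; move: uPE; rewrite (perm_uniq perm_all) cat_uniq.
  by rewrite has_sym => /and3P[].
have sP1 : {subset P1 <= P} by move=> a aP; rewrite (perm_mem pP) mem_cat aP.
have sP2 : {subset P2 <= P} by move=> a aP; rewrite (perm_mem pP) mem_cat aP orbT.
have sE1 : {subset E1 <= E} by move=> a aE; rewrite (perm_mem pE) mem_cat aE.
have sE2 : {subset E2 <= E} by move=> a aE; rewrite (perm_mem pE) mem_cat aE orbT.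
have dPE1 : [disjoint P & E1] by apply: disjointWr dPE; apply/subsetP.
have dPE2 : [disjoint P & E2] by apply: disjointWr dPE; apply/subsetP.
have SE : [set:: P ++ E] = [set:: P1 ++ E1] :|: [set:: P2 ++ E2].
  by apply/setP=> a; rewrite !inE -(perm_mem perm_all) mem_cat.
rewrite /ext_M SE (dual_mul eps_or uPE _ _ H1 H2) => [|a|a]; rewrite ?inE //.
rewrite linearZ /= !rmorphM /=.
rewrite (iota_g_sub sP1 dPE1 H1) (iota_g_sub sP2 dPE2 H2).
rewrite (upsilon_r_sub sP1 dPE1 H1') (upsilon_r_sub sP2 dPE2 H2').
have I2 := homog_sub (subsetT _) (homog_iota H2).
have Y1 := homog_sub (subsetT _) (homog_upsilon H1').
set y1 := upsilon_r r P1 _ in Y1 *; set i2 := iota_g g P2 _ in I2 *.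
rewrite -scalerAr -!scalerA; do 3!congr (_ *: _).
(* Commuting iota(N2) with upsilon(N1^dual) repeats the sign left by [dual_mul], and the two
   cancel. *)
rewrite -(mulrA _ i2) (mulrA i2 y1) (homog_comm I2 Y1).
by rewrite -!(scalerAl, scalerAr) !mulrA scalerA -signr_addb addbb scale1r.
Qed.

Lemma ext_ME_mul P1 E1 P2 E2 P E b1 b2 N1 N2 :
    uniq ((P1 ++ E1) ++ (P2 ++ E2)) -> perm_eq P (P1 ++ P2) -> perm_eq E (E1 ++ E2) ->
    homog [set:: P1 ++ E1] b1 N1 -> homog [set:: P2 ++ E2] b2 N2 ->
  ext_ME eps g r P E (N1 * N2) =
    (eps (P1 ++ P2 ++ E) * eps (P1 ++ E1) * eps (P2 ++ E2))%:~R
      *: (ext_ME eps g r P1 E1 N1 * ext_ME eps g r P2 E2 N2).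
Proof.
move=> uPE pP pE H1 H2.
have perm_all : perm_eq ((P1 ++ E1) ++ (P2 ++ E2)) ((P1 ++ P2) ++ (E1 ++ E2)).
  by rewrite -!catA perm_cat2l perm_catCA.
have uPE' : uniq ((P1 ++ P2) ++ E).
  by rewrite (perm_uniq (perm_cat (perm_refl _) pE)) -(perm_uniq perm_all).
have [uPE1 /hasPn dPE uPE2] := and3P (etrans (esym (cat_uniq _ _)) uPE).
have M1 := homog_ext_M H1 uPE1; have M2 := homog_ext_M H2 uPE2.
have M1T := homog_sub (subsetT _) M1; have M2T := homog_sub (subsetT _) M2.
have Q2 := homog_contraction_seq (map (@nonport U) E2) M2.
rewrite /ext_ME.
have eE := contraction_seq_perm (@nonport U) (ext_M eps g r P E (N1 * N2))
  (orientation_alternating_catl K eps_or (P1 ++ P2)) pE.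
(* Inserting eps(P1 P2 E) squared lets one factor absorb the reordering of E into E1 E2; the other
   stays in the result. *)
rewrite -[LHS]scale1r -[X in X *: _ = _](orientation_sqr K eps_or uPE') -scalerA {}eE.
rewrite map_cat /contraction_seq foldr_cat -!/(contraction_seq _ _).
rewrite (ext_M_mul uPE pP pE H1 H2) !contraction_seqZ.
rewrite (contraction_seq_mulr _ M1 M2T) => [|w /mapP[e eE2 ->]]; last first.
  rewrite inE; apply/negP => eE1; have := dPE e.
  by rewrite !mem_cat eE1 eE2 !orbT => /(_ isT).
rewrite (contraction_seq_mull _ M1T Q2) => [|w /mapP[e eE1 ->]]; last first.
  rewrite !inE negb_and; apply/orP; right; apply/negP => eE2.
  by have := dPE e; rewrite !mem_cat eE1 eE2 !orbT => /(_ isT).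
(* Contracted by E2, M(N2) has parity |P2|; the sign |E1| |P2| is also that of exchanging E1 and P2
   in eps(P1 E1 P2 E2). *)
rewrite !scalerA; congr (_ *: _); rewrite !size_map size_cat oddD addbK.
have := alternating_catCA P1 E1 P2 E2 (V := K^o) (orientation_alternating_catl K eps_or [::]).
rewrite -[_ *: _]/(_ * _) /= !intrM -!catA => ->.
rewrite -!catA in uPE' *.
set z := _ ^+ _; set w := (eps (P1 ++ P2 ++ E1 ++ E2))%:~R.
have z2 : z * z = 1 by rewrite /z -signr_addb addbb.
have w2 : w * w = 1.
  apply: (orientation_sqr K eps_or); rewrite (catA P1).
  by rewrite -(perm_uniq perm_all).
set u := (eps (P1 ++ P2 ++ E))%:~R; set a1 := (eps (P1 ++ E1))%:~R.
set a2 := (eps (P2 ++ E2))%:~R.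
transitivity (u * a1 * a2 * (z * z) * (w * w)); first ring.
by rewrite z2 w2 !mulr1.
Qed.

Lemma ext_M_contraction P E e b N : uniq (P ++ rcons E e) ->
    homog [set:: P ++ rcons E e] b N ->
  contraction (ext_M eps g r P (rcons E e) N) (nonport e) =
    (eps (P ++ rcons E e) * eps (P ++ E))%:~R *:
      (g e *: ext_M eps g r P E (contraction N e)
       + r e *: ext_M eps g r P E (deletion N e)).
Proof.
move=> uPEe HN; set S := [set:: P ++ E]; have uPEe' := uPEe.
move: (uPEe); rewrite -rcons_cat rcons_uniq mem_cat negb_or.
move=> /andP[/andP[ePN eEN] uPE].
have SE : [set:: P ++ rcons E e] = e |: S.
  by apply/setP=> a; rewrite !inE -rcons_cat mem_rcons inE.
have eS : e \notin S by rewrite inE mem_cat negb_or ePN.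
have [x [y [Hx Hy NE]]] := homog_split e HN.
have {}Hx : homog S b x by move: Hx; rewrite SE setU1K.
have {}Hy : homog S (~~ b) y by move: Hy; rewrite SE setU1K.
rewrite {2 3}NE (contraction_split eS Hx Hy) (deletion_split eS Hx Hy).
have s0E : P ++ E =i S by move=> a; rewrite inE.
rewrite -rcons_cat in uPEe'.
rewrite /ext_M -/S SE NE dualD (dual_extend eps_or uPEe' s0E Hx).
rewrite (dual_extend_mul_gen eps_or uPEe' s0E Hy).
rewrite [iota_g _ _ (_ + _)]raddfD [upsilon_r _ _ (_ + _)]raddfD /=.
rewrite ![upsilon_r _ _ (_ *: _)]linearZ /=.
rewrite [iota_g _ _ (_ * _)]rmorphM [upsilon_r _ _ (_ * _)]rmorphM /=.
rewrite rcons_cat.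
have -> : iota_g g P (ext_gen K e) = g e *: ext_gen K (nonport e).
  by rewrite /iota_g (ext_lift_gen (iota_gen_vector g P)) /iota_gen (negPf ePN).
have -> : upsilon_r r P (ext_gen K e) = r e *: ext_gen K (nonport e).
  by rewrite /upsilon_r (ext_lift_gen (upsilon_gen_vector r P)) /upsilon_gen (negPf ePN).
have Ix := homog_iota Hx; have Iy := homog_iota Hy.
have Yx := homog_upsilon (homog_dual eps_or Hx).
have Yy := homog_upsilon (homog_dual eps_or Hy).
set c := (_ * _)%:~R; set d := odd #|S| in Yx Yy *.
set ix := iota_g g P x in Ix *; set iy := iota_g g P y in Iy *.
set yx := upsilon_r r P (dual eps S x) in Yx *.
set yy := upsilon_r r P (dual eps S y) in Yy *.
set W := split_ports P E in Ix Iy Yx Yy.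
have eW : nonport e \notin W by rewrite inE.
set G := ext_gen K (nonport e).
have GG : G * G = 0 by apply: ext_gen_sq.
have Gcomm d' a z : homog W d' z -> a * G * z = (-1) ^+ d' *: (a * z * G).
  move=> Hz; rewrite -mulrA.
  rewrite (homog_comm (homog_gen K (in_setT _)) (homog_sub (subsetT _) Hz)) /=.
  by rewrite -scalerAr mulrA.
(* The product is put in the form u + v e, from which contraction by e reads off v. The sign in the
   dual of y e cancels against moving e past [yy]. *)
have prodE : (ix + iy * (g e *: G)) *
      (c *: (yx * (r e *: G)) + (c * (-1) ^+ (d (+) ~~ b)) *: yy)
    = (c * (-1) ^+ (d (+) ~~ b)) *: (ix * yy)
      + (c *: (g e *: (iy * yy) + r e *: (ix * yx))) * G.
  rewrite mulrDl !mulrDr -!(scalerAl, scalerAr) !mulrA (Gcomm _ _ _ Yx) (Gcomm _ _ _ Yy).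
  rewrite -scalerAl -(mulrA _ G) GG mulr0 !scaler0 add0r.
  rewrite [X in _ = _ + _ *: X]mulrDl -!scalerAl scalerDr.
  rewrite (addrC (c *: _)) -addrA; congr (_ + _); rewrite addrC; congr (_ + _).
  rewrite !scalerA; congr (_ *: _); set z := (-1) ^+ _.
  have z2 : z * z = 1 by rewrite /z -signr_addb addbb.
  by rewrite -mulrA -(mulrA c) z2 mulr1 mulrC.
rewrite prodE; have Hu := homogZ (c * (-1) ^+ (d (+) ~~ b)) (homogM Ix Yy).
have Hv1 := homogM Iy Yy; have Hv2 := homogM Ix Yx.
(* The two terms of v must have one parity, which is |S| for both. *)
have eqb : b (+) (d (+) b) = ~~ b (+) (d (+) ~~ b).
  by rewrite addbN addNb addbN negbK.
rewrite eqb in Hv2.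
have Hv := homogZ c (homogD (homogZ (g e) Hv1) (homogZ (r e) Hv2)).
by rewrite (contraction_split eW Hu Hv).
Qed.

Lemma ext_ME_contraction P E e b N : uniq (P ++ E) -> e \in E ->
    homog [set:: P ++ E] b N ->
  ext_ME eps g r P E N = (eps (P ++ E) * eps (P ++ rem e E))%:~R *:
    (g e *: ext_ME eps g r P (rem e E) (contraction N e)
     + r e *: ext_ME eps g r P (rem e E) (deletion N e)).
Proof.
move=> uPE eE HN.
have pE : perm_eq E (rcons (rem e E) e).
  by rewrite perm_sym perm_rcons perm_sym perm_to_rem.
have pPE : perm_eq (P ++ E) (P ++ rcons (rem e E) e) by rewrite perm_cat2l.
have uPE' : uniq (P ++ rcons (rem e E) e) by rewrite -(perm_uniq pPE).
have SE : [set:: P ++ E] = [set:: P ++ rcons (rem e E) e].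
  by apply/setP=> a; rewrite !inE (perm_mem pPE).
rewrite (ext_ME_perm _ uPE pE).
have -> : ext_M eps g r P E N = ext_M eps g r P (rcons (rem e E) e) N.
  by rewrite /ext_M SE.
(* Being last in the sequence, e is contracted first. *)
rewrite map_rcons /contraction_seq -[rcons (map _ _) _]cats1 foldr_cat /=.
rewrite SE in HN; rewrite (ext_M_contraction uPE' HN).
rewrite -/(contraction_seq _ _) contraction_seqZ contraction_seqD !contraction_seqZ.
rewrite scalerA; congr (_ *: _); rewrite !intrM -!mulrA; congr (_ * _).
by rewrite mulrA (orientation_sqr K eps_or uPE') mul1r.
Qed.

(** The two factors live on disjoint copies of the ports, so the iota part of a monomial can only
    match I and its upsilon part only V. *)
Lemma plucker_ports P b1 b2 x y I V :
    homog [set:: P] b1 x -> homog [set:: P] b2 y -> uniq I -> uniq V ->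
  plucker (iota_g g P x * upsilon_r r P y)
    (map (@port_iota U) I ++ map (@port_upsilon U) V) = plucker x I * plucker y V.
Proof.
move=> Hx Hy uI uV; elim: Hx => [|u v _ IHu _ IHv|c u _ IHu|s us sP ps].
- by rewrite raddf0 mul0r !plucker0 mul0r.
- by rewrite raddfD mulrDl !pluckerD mulrDl IHu IHv.
- by rewrite linearZ -scalerAl !pluckerZ IHu mulrA.
elim: Hy => [|u v _ IHu _ IHv|c u _ IHu|t ut tP pt].
- by rewrite raddf0 mulr0 !plucker0 mulr0.
- by rewrite raddfD mulrDr !pluckerD mulrDr IHu IHv.
- by rewrite linearZ -scalerAr !pluckerZ IHu mulrCA.
have uports A B : uniq A -> uniq B ->
    uniq (map (@port_iota U) A ++ map (@port_upsilon U) B).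
  move=> uA uB; rewrite cat_uniq !map_inj_uniq ?uA ?uB; try by move=> ? ? [].
  by rewrite andbT; apply/hasPn=> _ /mapP[a _ ->]; apply/mapP=> -[].
have permP (A B A' B' : seq U) :
    perm_eq (map (@port_iota U) A ++ map (@port_upsilon U) B)
      (map (@port_iota U) A' ++ map (@port_upsilon U) B') ->
    uniq A -> uniq B -> uniq A' -> uniq B' -> perm_eq A A' /\ perm_eq B B'.
  move=> /perm_mem pAB uA uB uA' uB'; split; apply: uniq_perm => // a.
    have := pAB (port_iota a); rewrite !mem_cat !mem_map; try by move=> ? ? [].
    have nin C : port_iota a \notin map (@port_upsilon U) C by apply/mapP=> -[].
    by rewrite !(negPf (nin _)) !orbF.
  have := pAB (port_upsilon a).
  rewrite !mem_cat ![_ \in map (@port_upsilon U) _]mem_map; try by move=> ? ? [].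
  have nin C : port_upsilon a \notin map (@port_iota U) C by apply/mapP=> -[].
  by rewrite !(negPf (nin _)).
have sP' : {subset s <= P} by move=> a /sP; rewrite inE.
have tP' : {subset t <= P} by move=> a /tP; rewrite inE.
have [pI|npI] := boolP (perm_eq s I); last first.
  rewrite (plucker_mon_neq _ us uI npI) mul0r iota_g_mon // upsilon_r_mon // -ext_monM.
  by rewrite plucker_mon_neq ?uports //; apply: contra npI => /permP[].
have [pV|npV] := boolP (perm_eq t V); last first.
  rewrite (plucker_mon_neq _ ut uV npV) mulr0 iota_g_mon // upsilon_r_mon // -ext_monM.
  by rewrite plucker_mon_neq ?uports //; apply: contra npV => /permP[].
have sI : {subset I <= P} by move=> a; rewrite -(perm_mem pI) => /sP'.
have sV : {subset V <= P} by move=> a; rewrite -(perm_mem pV) => /tP'.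
(* The monomials of s and t are rewritten as signed monomials of I and V, whose own coordinates are
   1. *)
rewrite -(plucker_mon_perm (alternating_mon K U) us pI).
rewrite -(plucker_mon_perm (alternating_mon K U) ut pV).
rewrite !linearZ /= -scalerAl -scalerAr !pluckerZ iota_g_mon // upsilon_r_mon //.
by rewrite -ext_monM !plucker_mon_id ?uports // !mulr1.
Qed.

Lemma plucker_ext_ME_nil P b N I V Vbar : uniq P -> homog [set:: P] b N ->
    {subset V <= P} -> uniq Vbar -> Vbar =i [predD P & V] ->
  plucker (ext_ME eps g r P [::] N)
    (map (@port_iota U) I ++ map (@port_upsilon U) V) =
  (eps (Vbar ++ V))%:~R * plucker N I * plucker N Vbar.
Proof.
move=> uP HN sV uVbar VbarE; have [[eps0 _] _ _ _] := eps_or.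
(* A repetition in I or V makes both sides vanish. *)
have [uI|nuI] := boolP (uniq I); last first.
  rewrite (plucker_alternating N).1 // mulr0 mul0r (plucker_alternating _).1 //.
  by rewrite cat_uniq map_inj_uniq ?(negPf nuI) // => ? ? [].
have [uV|nuV] := boolP (uniq V); last first.
  rewrite eps0 ?mul0r ?(plucker_alternating _).1 // cat_uniq.
    by rewrite [uniq (map _ V)]map_inj_uniq ?(negPf nuV) ?andbF // => ? ? [].
  by rewrite (negPf nuV) !andbF.
rewrite /ext_ME /= /ext_M cats0 (plucker_ports HN (homog_dual eps_or HN)) //.
rewrite (plucker_dual _ eps_or _ uVbar) => [|a /sV|a].
- by rewrite mulrA [LHS]mulrC mulrA.
- by rewrite inE.
- by rewrite VbarE !inE.
Qed.

End PortedTheory.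

Theorem theorem16 (K : fieldType) (U : finType) (g r : U -> K)
    (eps : seq U -> int) (eps_or : orientation eps) :
  [/\ (* (1) *)
      forall (P1 E1 P2 E2 P E : seq U) (N1 N2 : ext K U),
        ported P1 E1 N1 -> ported P2 E2 N2 ->
        [disjoint P1 ++ E1 & P2 ++ E2] ->
        perm_eq P (P1 ++ P2) -> perm_eq E (E1 ++ E2) ->
        ext_ME eps g r P E (N1 * N2) =
          (eps (P1 ++ P2 ++ E) * eps (P1 ++ E1) * eps (P2 ++ E2))%:~R
            *: (ext_ME eps g r P1 E1 N1 * ext_ME eps g r P2 E2 N2),
      (* (2) *)
      forall (P E : seq U) (N : ext K U) (e : U),
        ported P E N -> e \in E ->
        let E' := rem e E in
        ext_ME eps g r P E N =
          (eps (P ++ E) * eps (P ++ E'))%:~R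
            *: (g e *: ext_ME eps g r P E' (contraction N e)
                + r e *: ext_ME eps g r P E' (deletion N e)),
      (* (3) *)
      forall (P : seq U) (N : ext K U) (I V Vbar : seq U),
        ported P [::] N ->
        {subset I <= P} -> {subset V <= P} ->
        uniq Vbar -> Vbar =i [predD P & V] ->
        plucker (ext_ME eps g r P [::] N)
                (map (@port_iota U) I ++ map (@port_upsilon U) V) =
          (eps (Vbar ++ V))%:~R * plucker N I * plucker N Vbar
    & (* (4) *)
      forall P E : seq U, uniq (P ++ E) -> ext_ME eps g r P E (0 : ext K U) = 0].
Proof.
split=> [P1 E1 P2 E2 P E N1 N2|P E N e|P N I V Vbar|P E uPE].
- move=> [u1 /(homog_extensor)[b1 H1]] [u2 /(homog_extensor)[b2 H2]] d12 pP pE.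
  apply: (ext_ME_mul g r eps_or _ pP pE H1 H2).
  by rewrite cat_uniq u1 u2 andbT has_sym -disjoint_has.
- by move=> [uPE /homog_extensor[b HN]] eE /=; apply: ext_ME_contraction HN.
- move=> [uP /homog_extensor[b HN]] _ sV uVbar VbarE; rewrite !cats0 in uP HN.
  exact: (plucker_ext_ME_nil g r eps_or I uP HN sV uVbar VbarE).
by rewrite /ext_ME /ext_M raddf0 mul0r contraction_seq0.
Qed.
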